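(* Let $T$ be a complete dependent theory with monster model $\mathfrak{C}$ and let $A\subseteq\mathfrak{C}$ be a (small) set. (i) Let $I=\langle a_i:i<|T|^+\rangle$ be a strictly nonforking sequence over $A$, and let $b$ be a finite tuple (or even a tuple of cardinality $\le|T|$). Then for all except at most $|T|$-many $i<|T|^+$, the type $\mathrm{tp}(b/Aa_i)$ does not divide over $A$. (ii) If $T$ is strongly dependent, $I$ is an infinite strictly nonforking sequence over $A$ and $b$ is a finite tuple, then for all but finitely many $a_i\in I$ the type $\mathrm{tp}(b/Aa_i)$ does not divide over $A$.
   Context: $T$ is a complete dependent (NIP) first-order theory, $T=T^{eq}$, with monster model $\mathfrak{C}$; the $a_i$ are elements or finite tuples. A global type is a complete type over $\mathfrak{C}$ (its realizations lie in a larger monster model). For sets $A\subseteq B$, a type $p\in S(B)$ is a strictly nondividing extension of $p\restriction A$ if for every $a\models p$: $\mathrm{tp}(a/B)$ does not divide over $A$, and $\mathrm{tp}(B/Aa)$ does not divide over $A$. A type $p\in S(B)$ is strictly free over $A$ if there is a global type $q$ extending $p$ which is a strictly nondividing extension of $p\restriction A$. A sequence $\langle a_i:i<\alpha\rangle$ (not necessarily indiscernible) is strictly nonforking over $A$ if for every $i<\alpha$ the type $\mathrm{tp}(a_i/Aa_{<i})$ is strictly free over $A$, where $a_{<i}=\langle a_j:j<i\rangle$. $T$ is strongly dependent if there do not exist formulas $\varphi_i(x,y_i)$ ($i<\omega$, $x$ a finite tuple of variables) and an array $\langle b_{i,j}:i,j<\omega\rangle$ such that for every $\eta:\omega\to\omega$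 the set $\{\varphi_i(x,b_{i,\eta(i)}):i<\omega\}\cup\{\neg\varphi_i(x,b_{i,j}):i<\omega,\ j\ne\eta(i)\}$ is consistent. *)

(* Defs.v *)
From mathcomp Require Import all_boot.
From mathcomp Require Import boolp classical_sets functions cardinality.
From mathcomp Require wochoice.
Set Implicit Arguments.
Unset Strict Implicit.
Unset Printing Implicit Defensive.
Local Open Scope classical_set_scope.
Local Open Scope card_scope.

(* Many-sorted first-order logic: since T = T^eq, the elements of the monster
   model range over all the imaginary sorts. *)

Record language := Language {
  lsort : Type;
  fsym : Type;
  farity : fsym -> nat;
  fdom : forall f, 'I_(farity f) -> lsort;
  fcod : fsym -> lsort;
  rsym : Type;
  rarity : rsym -> nat;
  rdom : forall r, 'I_(rarity r) -> lsort }.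

(* A context is a tuple of sorted variables, of arbitrary length. *)
Record ctx (L : language) := Ctx { idx :> Type; srt : idx -> lsort L }.

Record fctx (L : language) := Fctx { flen : nat; fsrt : 'I_flen -> lsort L }.

Definition ctx_of_fctx L (X : fctx L) : ctx L := Ctx (@fsrt L X).
Coercion ctx_of_fctx : fctx >-> ctx.

Definition cnil L : fctx L :=
  @Fctx L 0 (fun i => match notF (ltn_ord i) with end).

Definition csingle L (s : lsort L) : fctx L := @Fctx L 1 (fun=> s).

Definition csum L (X Y : ctx L) : ctx L :=
  Ctx (fun v : X + Y => match v with inl x => srt x | inr y => srt y end).

Definition cext L (X : ctx L) (s : lsort L) : ctx L :=
  Ctx (fun v : option X => match v with Some x => srt x | None => s end).

Definition call L : ctx L := Ctx (fun v : lsort L * nat => v.1).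

Inductive term L (X : ctx L) : lsort L -> Type :=
| Var (x : X) : term X (srt x)
| App (f : fsym L) (t : forall i, term X (@fdom L f i)) : term X (fcod f).

(* The variables of a formula are the members of its context; the variable
   bound by [All s] is [None] in the extended context. *)
Inductive formula L (X : ctx L) : Type :=
| Fls
| Eql (s : lsort L) (t u : term X s)
| Rel (r : rsym L) (t : forall i, term X (@rdom L r i))
| Imp (phi psi : formula X)
| All (s : lsort L) (phi : formula (cext X s)).

Arguments Fls {L X}.

Definition Neg L (X : ctx L) (phi : formula X) : formula X := Imp phi Fls.

Definition sentence L := formula (cnil L).

(* |T| is the cardinality of this set (it is at least aleph_0). *)
Definition card_theory L : set (formula (call L)) := [set: formula (call L)].

Arguments card_theory L _ : clear implicits.

Record structure (L : language) := Structure {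
  carrier :> lsort L -> Type;
  finterp : forall f : fsym L,
    (forall i, carrier (@fdom L f i)) -> carrier (fcod f);
  rinterp : forall r : rsym L, (forall i, carrier (@rdom L r i)) -> Prop }.

Definition tup L (X : ctx L) (M : structure L) := forall x : X, M (srt x).

Definition tcat L (M : structure L) (X Y : ctx L)
    (a : tup X M) (b : tup Y M) : tup (csum X Y) M :=
  fun v => match v with inl x => a x | inr y => b y end.

Definition text L (M : structure L) (X : ctx L) (s : lsort L)
    (a : tup X M) (m : M s) : tup (cext X s) M :=
  fun v => match v with Some x => a x | None => m end.

Definition tsingle L (M : structure L) (s : lsort L) (m : M s) :
  tup (csingle s) M := fun=> m.

Definition tnil L (M : structure L) : tup (cnil L) M :=
  fun i => match notF (ltn_ord i) with end.

Fixpoint teval L (M : structure L) (X : ctx L) (a : tup X M) (s : lsort L)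
    (t : term X s) : M s :=
  match t with
  | Var x => a x
  | App f u => finterp (fun i => teval a (u i))
  end.

Fixpoint sat L (M : structure L) (X : ctx L) (phi : formula X) :
    tup X M -> Prop :=
  match phi with
  | Fls => fun=> False
  | Eql s t u => fun a => teval a t = teval a u
  | Rel r t => fun a => rinterp (fun i => teval a (t i))
  | Imp phi1 phi2 => fun a => sat phi1 a -> sat phi2 a
  | All s phi1 => fun a => forall m : M s, sat phi1 (text a m)
  end.

Definition models L (M : structure L) (T : set (sentence L)) :=
  forall sigma, T sigma -> sat sigma (@tnil L M).

Definition complete L (T : set (sentence L)) :=
  (exists M : structure L, models M T) /\
  forall sigma : sentence L,
    (forall M : structure L, models M T -> sat sigma (@tnil L M)) \/
    (forall M : structure L, models M T -> sat (Neg sigma) (@tnil L M)).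

(* T = T^eq: modulo T, every 0-definable equivalence relation on a finite
   product of sorts is the kernel of a 0-definable surjection onto a sort. *)
Definition eq_relation_in L (M : structure L) (X : fctx L)
    (E : formula (csum X X)) :=
  [/\ forall a : tup X M, sat E (tcat a a),
      forall a b : tup X M, sat E (tcat a b) -> sat E (tcat b a)
    & forall a b c : tup X M,
        sat E (tcat a b) -> sat E (tcat b c) -> sat E (tcat a c)].

Definition quotient_in L (M : structure L) (X : fctx L)
    (E : formula (csum X X)) (s : lsort L) (F : formula (csum X (csingle s))) :=
  exists f : tup X M -> M s,
    [/\ forall a m, sat F (tcat a (tsingle m)) <-> f a = m,
        forall m, exists a, f a = m
      & forall a b, f a = f b <-> sat E (tcat a b)].

Definition equals_Teq L (T : set (sentence L)) :=
  forall (X : fctx L) (E : formula (csum X X)),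
    (forall M : structure L, models M T -> eq_relation_in M E) ->
    exists (s : lsort L) (F : formula (csum X (csingle s))),
      forall M : structure L, models M T -> quotient_in M E F.

Definition elt L (M : structure L) := {s : lsort L & M s}.

Definition el L (M : structure L) (X : ctx L) (a : tup X M) (x : X) :
  elt M := existT _ (srt x) (a x).

Definition range_of L (M : structure L) (X : ctx L) (a : tup X M) :
  set (elt M) := [set e | exists x, el a x = e].

(* A set of elements, enumerated by itself. *)
Definition cset L (M : structure L) (B : set (elt M)) : ctx L :=
  Ctx (fun e : {e | B e} => projT1 (proj1_sig e)).

Definition tset L (M : structure L) (B : set (elt M)) : tup (cset B) M :=
  fun e => projT2 (proj1_sig e).

(* The formula phi(x, c), with x in X and c a finite tuple in M. *)
Record pfml L (M : structure L) (X : ctx L) := PFml {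
  pctx : fctx L;
  pform : formula (csum X pctx);
  par : tup pctx M }.

Arguments par {L M X} p x.

Definition pneg L (M : structure L) (X : ctx L) (psi : pfml M X) : pfml M X :=
  PFml (Neg (pform psi)) (par psi).

Definition psat L (M : structure L) (X : ctx L) (psi : pfml M X)
    (a : tup X M) := sat (pform psi) (tcat a (par psi)).

Definition pover L (M : structure L) (X : ctx L) (B : set (elt M)) :
  set (pfml M X) := [set psi | range_of (par psi) `<=` B].

(* Consistent with the elementary diagram of M. *)
Definition consistent L (M : structure L) (X : ctx L) (p : set (pfml M X)) :=
  forall F : set (pfml M X), finite_set F -> F `<=` p ->
    exists a : tup X M, forall psi, F psi -> psat psi a.

Definition realizes L (M : structure L) (X : ctx L) (p : set (pfml M X))
    (a : tup X M) := forall psi, p psi -> psat psi a.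

(* p belongs to S(B). *)
Definition is_type L (M : structure L) (X : ctx L) (B : set (elt M))
    (p : set (pfml M X)) :=
  [/\ p `<=` pover B, consistent p
    & forall psi, pover B psi -> p psi \/ p (pneg psi)].

Definition tp L (M : structure L) (X : ctx L) (a : tup X M)
    (B : set (elt M)) : set (pfml M X) :=
  [set psi | pover B psi /\ psat psi a].

Definition has_IP L (M : structure L) (X Y : fctx L)
    (phi : formula (csum X Y)) :=
  exists c : nat -> tup Y M, forall S : set nat,
    consistent ([set PFml phi (c i) | i in S] `|`
                [set PFml (Neg phi) (c i) | i in ~` S]).

Definition dependent L (T : set (sentence L)) :=
  ~ exists M : structure L, models M T /\
      exists (X Y : fctx L) (phi : formula (csum X Y)), has_IP M phi.

Definition strongly_dependent L (T : set (sentence L)) :=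
  ~ exists M : structure L, models M T /\
      exists (X : fctx L) (Y : nat -> fctx L)
             (phi : forall i, formula (csum X (Y i)))
             (b : forall i, nat -> tup (Y i) M),
        forall eta : nat -> nat,
          consistent
            ([set psi | exists i, psi = PFml (phi i) (b i (eta i))] `|`
             [set psi | exists i j, j <> eta i /\
                                    psi = PFml (Neg (phi i)) (b i j)]).

(* A cardinal kappa is given by a type of that cardinality. *)

Definition card_lt (U V : Type) (A : set U) (B : set V) : Prop :=
  (A #<= B) /\ ~ (B #<= A).

Definition saturated L (kappa : Type) (M : structure L) :=
  forall (X : fctx L) (B : set (elt M)) (p : set (pfml M X)),
    card_lt B [set: kappa] -> p `<=` pover B -> consistent p ->
    exists a, realizes p a.

Definition automorphism L (M : structure L) (g : forall s, M s -> M s) :=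
  [/\ forall s, bijective (g s),
      forall (f : fsym L) (u : forall i, M (@fdom L f i)),
        g _ (finterp u) = finterp (fun i => g _ (u i))
    & forall (r : rsym L) (u : forall i, M (@rdom L r i)),
        rinterp u <-> rinterp (fun i => g _ (u i))].

Definition tmap L (M N : structure L) (h : forall s, M s -> N s) (X : ctx L)
    (a : tup X M) : tup X N := fun x => h _ (a x).

Definition strongly_homogeneous L (kappa : Type) (M : structure L) :=
  forall (X : ctx L) (a b : tup X M),
    card_lt [set: X] [set: kappa] -> tp a set0 = tp b set0 ->
    exists g : forall s, M s -> M s, automorphism g /\ tmap g a = b.

Definition monster L (T : set (sentence L)) (kappa : Type) (M : structure L) :=
  [/\ models M T, card_lt (card_theory L) [set: kappa],
      saturated kappa M & strongly_homogeneous kappa M].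

Definition elementary L (M N : structure L) (h : forall s, M s -> N s) :=
  forall (X : ctx L) (phi : formula X) (a : tup X M),
    sat phi a <-> sat phi (tmap h a).

Definition divides L (M : structure L) (X : ctx L) (A : set (elt M))
    (psi : pfml M X) :=
  exists (k : nat) (c : nat -> tup (pctx psi) M),
    (forall j, tp (c j) A = tp (par psi) A) /\
    forall J : seq nat, uniq J -> size J = k ->
      ~ exists x : tup X M,
          forall j, j \in J -> sat (pform psi) (tcat x (c j)).

(* Only used for complete types, which are closed under conjunction, so that
   "implies a dividing formula" is "contains a dividing formula". *)
Definition tp_divides L (M : structure L) (X : ctx L) (A : set (elt M))
    (p : set (pfml M X)) := exists psi, p psi /\ divides A psi.

Definition strictly_nondividing L (M : structure L) (X : ctx L)
    (A B : set (elt M)) (p : set (pfml M X)) :=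
  [/\ A `<=` B, is_type B p
    & forall a : tup X M, realizes p a ->
        ~ tp_divides A (tp a B) /\
        ~ tp_divides A (tp (@tset L M B) (A `|` range_of a))].

(* C embeds in a larger monster model N through h; global types are complete
   types over C, and their realizations lie in N. *)

Definition emap L (M N : structure L) (h : forall s, M s -> N s) (e : elt M) :
  elt N := existT _ (projT1 e) (h _ (projT2 e)).

Definition pmap_par L (M N : structure L) (h : forall s, M s -> N s) (X : ctx L)
    (psi : pfml M X) : pfml N X := PFml (pform psi) (tmap h (par psi)).

Arguments pmap_par {L M N} h {X} psi.

Definition strictly_free L (C N : structure L) (h : forall s, C s -> N s)
    (X : ctx L) (A : set (elt C)) (p : set (pfml C X)) :=
  exists q : set (pfml C X),
    [/\ is_type setT q, p `<=` q
      & strictly_nondividing (emap h @` A) (range (emap h)) (pmap_par h @` q)].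

(* R is the non-strict order of the index set, an ordinal. *)
Definition before L (M : structure L) (I : Type) (R : rel I) (X : I -> fctx L)
    (a : forall i, tup (X i) M) (i : I) : set (elt M) :=
  [set e | exists j, [/\ R j i, j <> i & range_of (a j) e]].

Definition strictly_nonforking L (C N : structure L)
    (h : forall s, C s -> N s) (A : set (elt C)) (I : Type) (R : rel I)
    (X : I -> fctx L) (a : forall i, tup (X i) C) :=
  forall i, strictly_free h A (tp (a i) (A `|` before R a i)).

(* The well-order R on I has the order type of the initial ordinal
   (least cardinal above that of S). *)
Definition successor_cardinal (U : Type) (S : set U) (I : Type) (R : rel I) :=
  [/\ wochoice.well_order R, ~ ([set: I] #<= S)
    & forall i, [set j | R j i /\ j <> i] #<= S].

(* Main.v *)
Require Import Defs.
From mathcomp Require Import all_boot.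
From mathcomp Require Import boolp classical_sets functions cardinality filter.
From mathcomp Require wochoice.
Set Implicit Arguments.
Unset Strict Implicit.
Unset Printing Implicit Defensive.
Local Open Scope classical_set_scope.
Local Open Scope card_scope.

(* Let [d_n] be the parameters of a formula [phi_n(y, d_n)] of tp(b/A a_n) which
   divides over [A], for an increasing sequence of indices.  By induction on [n]
   there are arrays with [n] rows, the [i]-th one consisting of realizations of
   tp(d_i/A) on which [phi_i] is [k_i]-inconsistent, all of whose branches have
   the type of [d_0, ..., d_(n-1)] over [A].  For the inductive step, make the
   rows mutually indiscernible over [A], starting with the [d_i], and let [d']
   be obtained from a realization of a strictly nondividing global extension of
   the type of [a_n].  As tp(d'/C) does not divide over [A] and [T] is dependent,
   all the branches have the same type over [A d']; as tp(C/A d') does not divide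
   over [A], the array is consistent with arbitrarily many terms of a dividing
   sequence in place of [d'].  The infinite array obtained by compactness is an
   ict-pattern, since [b] satisfies all the [phi_n(y, d_n)]: this contradicts
   strong dependence, and dependence when the formulas [phi_n] are the same,
   which can be achieved when there are more than |T| of them. *)

(** * Renaming of variables and definable predicates *)

(** A global type is realized in [N], so nondividing produces arrays in [N], while the next stage
    needs an array in [C], where [A] and the [d_i] live. The induction therefore only asserts
    approximations in [N], for one formula and finitely many columns at a time, and a limit along a
    filter brings an array back to [C]. Saturation concerns types in finitely many variables; a
    countable array is realized one coordinate at a time along an ultrafilter. The same limits,
    applied to iterated ultrafilter quantifiers, yield mutually indiscernible rows without
    Ramsey-type theorems. A set of parameters is kept as one tuple enumerating it: a formula over
    [A] is a formula in a larger, possibly infinite context, and its finitely many parameters are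
    extracted only where a type or a dividing formula has to be exhibited. The same extraction
    handles an infinite [b] in (i): a dividing formula mentions finitely many of its coordinates. *)

Record cmap L (X X' : ctx L) := CMap {
  cfun :> X -> X';
  csrt : forall x, srt (cfun x) = srt x }.

Definition pull L (X X' : ctx L) (f : cmap X X') (M : structure L)
    (a : tup X' M) : tup X M :=
  fun x => ecast s (M s) (csrt f x) (a (f x)).

Fixpoint term_ren L (X X' : ctx L) (f : cmap X X') s (t : term X s) :
    term X' s :=
  match t with
  | Var x => ecast s (term X' s) (csrt f x) (Var (f x))
  | App g u => App (fun i => term_ren f (u i))
  end.

Lemma teval_ren L (M : structure L) (X X' : ctx L) (f : cmap X X') s
    (t : term X s) (a : tup X' M) :
  teval a (term_ren f t) = teval (pull f a) t.
Proof.
elim: t => [x|g u IH] /=; last by congr finterp; apply: functional_extensionality_dep.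
rewrite /pull; case: f => f e /=.
by move: (e x); move: (srt x) => s' e'; case: _ / e'.
Qed.

Definition cmap_ext L (X X' : ctx L) (f : cmap X X') s :
    cmap (cext X s) (cext X' s) :=
  @CMap L (cext X s) (cext X' s) (omap f)
    (fun v => match v with Some x => csrt f x | None => erefl end).

Fixpoint fml_ren L (X X' : ctx L) (f : cmap X X') (phi : formula X) :
    formula X' :=
  match phi in formula _ return formula X' with
  | Fls => Fls
  | Eql s t u => Eql (term_ren f t) (term_ren f u)
  | Rel r t => Rel (fun i => term_ren f (t i))
  | Imp phi psi => Imp (fml_ren f phi) (fml_ren f psi)
  | All s phi => All (fml_ren (cmap_ext f s) phi)
  end.

Lemma pull_text L (X X' : ctx L) (f : cmap X X') (M : structure L) s
    (a : tup X' M) (m : M s) :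
  pull (cmap_ext f s) (text a m) = text (pull f a) m.
Proof. by apply: functional_extensionality_dep => -[]. Qed.

Lemma sat_ren L (M : structure L) (X X' : ctx L) (f : cmap X X')
    (phi : formula X) (a : tup X' M) :
  sat (fml_ren f phi) a <-> sat phi (pull f a).
Proof.
elim: phi X' f a => //= [{}X s t u|{}X r t|{}X phi IH1 psi IH2|{}X s phi IH] X' f a.
- by rewrite !teval_ren.
- suff -> : (fun i => teval a (term_ren f (t i))) =
            (fun i => teval (pull f a) (t i)) by [].
  by apply: functional_extensionality_dep => i; rewrite teval_ren.
- by rewrite IH1 IH2.
- by split=> H m; have := H m; rewrite IH pull_text.
Qed.

(** * Predicates definable uniformly in all structures *)

Definition definable L (Z : ctx L)
    (D : forall M : structure L, tup Z M -> Prop) :=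
  exists phi : formula Z, forall M (a : tup Z M), sat phi a <-> D M a.

(** Coordinate selections: each entry of the result is a fixed entry of the argument, up to a cast
    between equal sorts, and the selection is the same in all structures. Definable predicates are
    closed under these substitutions. *)
Definition natural L (X Z : ctx L)
    (F : forall M : structure L, tup Z M -> tup X M) :=
  forall x : X, exists (z : Z) (e : srt z = srt x),
    forall M (a : tup Z M), F M a x = ecast s (M s) e (a z).

Lemma dchoice (X : Type) (Y : X -> Type) (P : forall x, Y x -> Prop) :
  (forall x, exists y, P x y) -> exists f : forall x, Y x, forall x, P x (f x).
Proof. by move=> H; exists (fun x => sval (cid (H x))) => x; case: cid. Qed.

Lemma cmap_choice L (X Z : ctx L) (T : structure L -> Type)
    (F : forall M, T M -> tup X M) (G : forall M, T M -> tup Z M) :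
  (forall x : X, exists (z : Z) (e : srt z = srt x),
     forall M (t : T M), F M t x = ecast s (M s) e (G M t z)) ->
  exists k : cmap X Z, forall M (t : T M), F M t = pull k (G M t).
Proof.
move=> /dchoice[f /dchoice[e H]]; exists (CMap e) => M t.
by apply: functional_extensionality_dep => x; rewrite H.
Qed.

Lemma natural_cmap L (X Z : ctx L) (F : forall M, tup Z M -> tup X M) :
  natural F -> exists k : cmap X Z, forall M a, F M a = pull k a.
Proof. exact: cmap_choice. Qed.

Lemma natural_pull L (X Z : ctx L) (k : cmap X Z) :
  natural (fun M => @pull L X Z k M).
Proof. by move=> x; exists (k x), (csrt k x). Qed.

Lemma natural_id L (X : ctx L) : @natural L X X (fun M a => a).
Proof. by move=> x; exists x, erefl. Qed.

Lemma natural_comp L (X Y Z : ctx L) (F : forall M, tup Y M -> tup X M)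
    (G : forall M, tup Z M -> tup Y M) :
  natural F -> natural G -> natural (fun M a => F M (G M a)).
Proof.
move=> nF nG x; have [y [e Fy]] := nF x; have [z [e' Gz]] := nG y.
exists z, (etrans e' e) => M a; rewrite Fy Gz.
by case: _ / e {Fy}.
Qed.

Definition tfst L (X Y : ctx L) (M : structure L) (a : tup (csum X Y) M) :
  tup X M := fun x => a (inl x).
Definition tsnd L (X Y : ctx L) (M : structure L) (a : tup (csum X Y) M) :
  tup Y M := fun y => a (inr y).

Lemma natural_fst L (X Y Z : ctx L) (F : forall M, tup Z M -> tup (csum X Y) M) :
  natural F -> natural (fun M a => tfst (F M a)).
Proof. by move=> nF x; have [z [e H]] := nF (inl x); exists z, e => M a; rewrite -H. Qed.

Lemma natural_snd L (X Y Z : ctx L) (F : forall M, tup Z M -> tup (csum X Y) M) :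
  natural F -> natural (fun M a => tsnd (F M a)).
Proof. by move=> nF x; have [z [e H]] := nF (inr x); exists z, e => M a; rewrite -H. Qed.

Lemma natural_cat L (X Y Z : ctx L) (F : forall M, tup Z M -> tup X M)
    (G : forall M, tup Z M -> tup Y M) :
  natural F -> natural G -> natural (fun M a => tcat (F M a) (G M a)).
Proof. by move=> nF nG [x|y] /=; [apply: nF|apply: nG]. Qed.

Ltac prove_natural :=
  match goal with
  | |- natural (fun M a => a) => exact: natural_id
  | |- natural (fun M a => tcat (@?F M a) (@?G M a)) =>
      refine (natural_cat (F := F) (G := G) _ _); prove_natural
  | |- natural (fun M a => tfst (@?F M a)) =>
      refine (natural_fst (F := F) _); prove_natural
  | |- natural (fun M a => tsnd (@?F M a)) =>
      refine (natural_snd (F := F) _); prove_natural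
  | |- natural (fun M a => pull ?k (@?F M a)) =>
      refine (natural_comp (F := fun M => @pull _ _ _ k M) (G := F) (natural_pull k) _);
      prove_natural
  | _ => first [exact: natural_pull | exact: natural_id | exact: natural_fst (@natural_id _ _)
      | exact: natural_snd (@natural_id _ _) | idtac]
  end.

Lemma def_ext L (Z : ctx L) (D D' : forall M : structure L, tup Z M -> Prop) :
  (forall M a, D M a <-> D' M a) -> definable D -> definable D'.
Proof. by move=> H [phi Hphi]; exists phi => M a; rewrite Hphi H. Qed.

Lemma def_comp L (X Z : ctx L) (D : forall M : structure L, tup X M -> Prop)
    (F : forall M, tup Z M -> tup X M) :
  definable D -> natural F -> definable (fun M a => D M (F M a)).
Proof.
move=> [phi H] /natural_cmap[k Hk]; exists (fml_ren k phi) => M a.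
by rewrite sat_ren -Hk H.
Qed.

Lemma def_sat L (X Z : ctx L) (phi : formula X)
    (F : forall M, tup Z M -> tup X M) :
  natural F -> definable (fun M a => sat phi (F M a)).
Proof.
by move=> nF; apply: (def_comp (D := fun M => @sat L M X phi)) nF; exists phi.
Qed.

Lemma def_imp L (Z : ctx L) (D D' : forall M : structure L, tup Z M -> Prop) :
  definable D -> definable D' -> definable (fun M a => D M a -> D' M a).
Proof.
by move=> [phi H] [psi H']; exists (Imp phi psi) => M a /=; rewrite H H'.
Qed.

Lemma def_false L (Z : ctx L) : @definable L Z (fun _ _ => False).
Proof. by exists Fls. Qed.

Lemma def_not L (Z : ctx L) (D : forall M : structure L, tup Z M -> Prop) :
  definable D -> definable (fun M a => ~ D M a).
Proof. by move=> dD; apply: def_imp dD (def_false Z). Qed.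

Lemma def_true L (Z : ctx L) : @definable L Z (fun _ _ => True).
Proof.
by exists (Neg Fls) => M a /=; split.
Qed.

Lemma def_and L (Z : ctx L) (D D' : forall M : structure L, tup Z M -> Prop) :
  definable D -> definable D' -> definable (fun M a => D M a /\ D' M a).
Proof.
move=> dD dD'; apply: def_ext (def_not (def_imp dD (def_not dD'))) => M a.
by split=> [/not_implyP[? /contrapT]|[? ?]]; [|apply].
Qed.

Lemma def_const L (Z : ctx L) (P : Prop) : @definable L Z (fun _ _ => P).
Proof.
have [p|np] := pselect P.
  by exists (Neg Fls) => M a /=; split.
by exists Fls => M a /=; split.
Qed.

Lemma def_iff L (Z : ctx L) (D D' : forall M : structure L, tup Z M -> Prop) :
  definable D -> definable D' -> definable (fun M a => D M a <-> D' M a).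
Proof. by move=> dD dD'; apply: def_and; apply: def_imp. Qed.

Lemma def_all_seq L (Z : ctx L) (I : eqType) (r : seq I)
    (D : I -> forall M : structure L, tup Z M -> Prop) :
  (forall i, definable (D i)) ->
  definable (fun M a => forall i, i \in r -> D i M a).
Proof.
move=> dD; elim: r => [|i r IH].
  by apply: def_ext (def_true Z) => M a; split.
apply: def_ext (def_and (dD i) IH) => M a; split.
  by move=> [Hi Hr] j; rewrite inE => /orP[/eqP->//|/Hr].
by move=> H; split=> [|j jr]; apply: H; rewrite inE ?eqxx ?jr ?orbT.
Qed.

Lemma def_all_lt L (Z : ctx L) n
    (D : nat -> forall M : structure L, tup Z M -> Prop) :
  (forall i, definable (D i)) ->
  definable (fun M a => forall i, i < n -> D i M a).
Proof.
move=> dD; apply: def_ext (def_all_seq (iota 0 n) dD) => M a.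
by split=> H i; have := H i; rewrite mem_iota.
Qed.

Lemma def_ex1 L (Z : ctx L) (s : lsort L)
    (D : forall M : structure L, tup (cext Z s) M -> Prop) :
  definable D -> definable (fun M a => exists m : M s, D M (text a m)).
Proof.
move=> /def_not[phi H]; exists (Neg (All phi)) => M a /=.
split=> [/existsNP[m]|[m Dm] /(_ m)]; rewrite H; last by apply.
by move=> /contrapT; exists m.
Qed.

(** Only one variable can be quantified at a time, so the first variable of the tuple is peeled off
    and the tail is indexed along [lift ord0]. *)
Lemma def_ex L (X : fctx L) (Z : ctx L)
    (D : forall M : structure L, tup (csum Z X) M -> Prop) :
  definable D -> definable (fun M a => exists x : tup X M, D M (tcat a x)).
Proof.
case: X D => n s D; elim: n s Z D => [|n IH] s Z D dD.
  pose nil M : tup (Fctx s) M := fun i => match notF (ltn_ord i) with end.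
  apply: def_ext (def_comp dD (F := fun M a => tcat a (nil M)) _).
    move=> M a; split=> [?|[x]]; first by exists (nil M).
    by congr (D M (tcat _ _)); apply: functional_extensionality_dep => -[].
  by apply: (natural_cat (F := fun M a => a) (G := fun M a => nil M)) =>
    [x|[]//]; exists x, erefl.
have [k Hk] : exists k : cmap (csum Z (Fctx s))
    (csum (cext Z (s ord0)) (Fctx (s \o lift ord0))),
  forall M (t : tup Z M * tup (Fctx s) M), tcat t.1 t.2 =
    pull k (tcat (text t.1 (t.2 ord0))
      ((fun j => t.2 (lift ord0 j)) : tup (Fctx (s \o lift ord0)) M)).
  apply: cmap_choice => -[z|i]; first by exists (inl (Some z)), erefl.
  by case: (unliftP ord0 i) => [j|] ->; [exists (inr j), erefl|exists (inl None), erefl].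
have dD' := def_comp dD (natural_pull k).
apply: def_ext (def_ex1 (IH _ _ _ dD')) => M a; split; last first.
  move=> [x Dx]; exists (x ord0), (fun j => x (lift ord0 j)).
  by rewrite -(Hk _ (a, x)).
move=> [m [x' Dx]].
(* The tuple with head [m] and tail [x'], specified by equations with casts because the sort depends
   on the index. *)
have /dchoice[x Hx] i : exists v : M (s i),
    (forall e : ord0 = i, v = ecast i (M (s i)) e m) /\
    (forall j (e : lift ord0 j = i), v = ecast i (M (s i)) e (x' j)).
  case: (unliftP ord0 i) => [j|] ->.
    exists (x' j); split=> [//|j' e]; have ej := lift_inj e; case: _ / ej in e *.
    by rewrite (eq_irrelevance e erefl).
  by exists m; split=> // e; rewrite (eq_irrelevance e erefl).
exists x; rewrite (Hk _ (a, x)) /=.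
have [/(_ erefl) -> _] := Hx ord0.
suff -> : (fun j => x (lift ord0 j)) = x' by [].
by apply: functional_extensionality_dep => j; have [_ /(_ j erefl)] := Hx (lift ord0 j).
Qed.

(** * Finite support of formulas *)

Definition vctx L (W : ctx L) (l : seq {classic W}) : fctx L :=
  @Fctx L (size l) (fun i => srt (tnth (in_tuple l) i : W)).

Definition vmap L (W : ctx L) (l : seq {classic W}) : cmap (vctx l) W :=
  @CMap L (vctx l) W (fun i => tnth (in_tuple l) i) (fun=> erefl).

Lemma teval_cast L (M : structure L) (X : ctx L) (a : tup X M) s s'
    (e : s = s') (t : term X s) :
  teval a (ecast s (term X s) e t) = ecast s (M s) e (teval a t).
Proof. by case: _ / e. Qed.

Lemma fin_union (T : eqType) (I : finType) (Q : I -> seq T -> Prop) :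
  (forall i, exists l : seq T, forall l' : seq T, {subset l <= l'} -> Q i l') ->
  exists l : seq T, forall l' : seq T, {subset l <= l'} -> forall i, Q i l'.
Proof.
move=> /choice[l Hl]; exists (flatten (map l (enum I))) => l' Hl' i.
apply: Hl => w wi; apply: Hl'; apply/flattenP; exists (l i) => //.
by apply: map_f; rewrite mem_enum.
Qed.

(** Stated for all lists containing [l], so that the lists of several subterms can be merged into
    one. *)
Lemma term_fin_par L (Z X W : ctx L) (f : cmap Z (csum X W)) s (t : term Z s) :
  exists l : seq {classic W}, forall l' : seq {classic W}, {subset l <= l'} ->
    exists t' : term (csum X (vctx l')) s,
    forall M (a : tup X M) (u : tup W M),
      teval (tcat a (pull (vmap l') u)) t' = teval (pull f (tcat a u)) t.
Proof.
elim: t => [z|g u IH].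
  rewrite /= /pull; move: (csrt f z); case: (f z) => [x|w] /= e.
    exists [::] => l' _; exists (ecast s (term _ s) e (Var (inl x : csum X (vctx l')))).
    by move=> M a u; rewrite teval_cast.
  exists [:: w] => l' /(_ w); rewrite inE eqxx => /(_ isT) wl'.
  have /tnthP[i Ei] : w \in in_tuple l' by [].
  move: e; rewrite Ei => e.
  exists (ecast s (term _ s) e (Var (inr i : csum X (vctx l')))).
  by move=> M a u; rewrite teval_cast.
have [l Hl] := fin_union IH; exists l => l' /Hl/dchoice[t' Ht'].
exists (App t') => M a v /=; congr finterp.
by apply: functional_extensionality_dep => i; rewrite Ht'.
Qed.

(** The splitting [f] of the context is arbitrary because of the binder: the bound variable joins
    the side [X], and only variables of [W] are collected. *)
Lemma fml_fin_par L (Z : ctx L) (phi : formula Z) :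
  forall (X W : ctx L) (f : cmap Z (csum X W)),
  exists l : seq {classic W}, forall l' : seq {classic W}, {subset l <= l'} ->
    exists phi' : formula (csum X (vctx l')),
    forall M (a : tup X M) (u : tup W M),
      sat phi' (tcat a (pull (vmap l') u)) <-> sat phi (pull f (tcat a u)).
Proof.
elim: phi => {Z} [Z|Z s t u|Z r t|Z phi IH1 psi IH2|Z s phi IH] X W f.
- by exists [::] => l' _; exists Fls.
- have [l1 H1] := term_fin_par f t; have [l2 H2] := term_fin_par f u.
  exists (l1 ++ l2) => l' sl.
  have [sl1 sl2] : {subset l1 <= l'} /\ {subset l2 <= l'}.
    by split=> w wl; apply: sl; rewrite mem_cat wl ?orbT.
  have [[t1 Ht1] [t2 Ht2]] := (H1 l' sl1, H2 l' sl2).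
  by exists (Eql t1 t2) => M a v /=; rewrite Ht1 Ht2.
- have [l Hl] := fin_union (fun i => term_fin_par f (t i)).
  exists l => l' /Hl/dchoice[t' Ht']; exists (Rel t') => M a v /=.
  suff -> : (fun i => teval (tcat a (pull (vmap l') v)) (t' i)) =
            (fun i => teval (pull f (tcat a v)) (t i)) by [].
  by apply: functional_extensionality_dep => i; rewrite Ht'.
- have [l1 H1] := IH1 X W f; have [l2 H2] := IH2 X W f.
  exists (l1 ++ l2) => l' sl.
  have [sl1 sl2] : {subset l1 <= l'} /\ {subset l2 <= l'}.
    by split=> w wl; apply: sl; rewrite mem_cat wl ?orbT.
  have [[t1 Ht1] [t2 Ht2]] := (H1 l' sl1, H2 l' sl2).
  by exists (Imp t1 t2) => M a v /=; rewrite Ht1 Ht2.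
have [k Hk] : exists k : cmap (cext Z s) (csum (cext X s) W),
    forall M (t : tup X M * tup W M * M s),
    text (pull f (tcat t.1.1 t.1.2)) t.2 = pull k (tcat (text t.1.1 t.2) t.1.2).
  apply: cmap_choice => -[z|]; last by exists (inl None), erefl.
  rewrite /= /pull; move: (csrt f z); case: (f z) => [x|w] /= e.
    by exists (inl (Some x)), e.
  by exists (inr w), e.
have [l Hl] := IH _ _ k; exists l => l' /Hl[phi' Hphi'].
have [k' Hk'] : exists k' : cmap (csum (cext X s) (vctx l')) (cext (csum X (vctx l')) s),
    forall M (t : tup X M * tup (vctx l') M * M s),
    tcat (text t.1.1 t.2) t.1.2 = pull k' (text (tcat t.1.1 t.1.2) t.2).
  apply: cmap_choice => -[[x|]|w]; first by exists (Some (inl x)), erefl.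
    by exists None, erefl.
  by exists (Some (inr w)), erefl.
exists (All (fml_ren k' phi')) => M a u /=.
split=> H m; have := H m; rewrite sat_ren -(Hk' _ (a, _, m)) /= Hphi';
  by rewrite -(Hk _ (a, u, m)).
Qed.

(** Removing duplicates makes [g] injective, which allows values of the finitely many variables to
    be extended to all of [W]. *)
Lemma fin_par L (X W : ctx L) (phi : formula (csum X W)) :
  exists (V : fctx L) (g : cmap V W) (phi' : formula (csum X V)), injective g /\
    forall M (a : tup X M) (u : tup W M),
      sat phi (tcat a u) <-> sat phi' (tcat a (pull g u)).
Proof.
have [k Hk] := natural_cmap (@natural_id L (csum X W)).
have [l /(_ (undup l))[w|phi' Hphi']] := fml_fin_par phi k.
  by rewrite mem_undup.
exists (vctx (undup l)), (vmap (undup l)), phi'; split=> [i j|M a u].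
  have ul : uniq (in_tuple (undup l)) by exact: undup_uniq.
  exact: (tuple_uniqP _ ul).
by rewrite Hphi' -Hk.
Qed.

(** * Types and dividing *)

Lemma tmap_pull L (C N : structure L) (h : forall s, C s -> N s) (X X' : ctx L)
    (k : cmap X X') (a : tup X' C) : tmap h (pull k a) = pull k (tmap h a).
Proof.
apply: functional_extensionality_dep => x; rewrite /tmap /pull.
by case: _ / (csrt k x).
Qed.

Lemma tmap_cat L (C N : structure L) (h : forall s, C s -> N s) (X Y : ctx L)
    (a : tup X C) (b : tup Y C) : tmap h (tcat a b) = tcat (tmap h a) (tmap h b).
Proof. by apply: functional_extensionality_dep => -[]. Qed.

Lemma tmap_natural L (C N : structure L) (h : forall s, C s -> N s)
    (X Z : ctx L) (F : forall M, tup Z M -> tup X M) (a : tup Z C) :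
  natural F -> tmap h (F C a) = F N (tmap h a).
Proof. by move=> /natural_cmap[k H]; rewrite !H tmap_pull. Qed.

Lemma def_elementary L (C N : structure L) (h : forall s, C s -> N s)
    (Z : ctx L) (D : forall M : structure L, tup Z M -> Prop) (a : tup Z C) :
  elementary h -> definable D -> D C a <-> D N (tmap h a).
Proof. by move=> hE [phi H]; rewrite -!H. Qed.

Lemma range_of_pull L (M : structure L) (X X' : ctx L) (k : cmap X X')
    (a : tup X' M) : range_of (pull k a) `<=` range_of a.
Proof.
move=> _ [x <-]; exists (k x); rewrite /el /pull.
by case: _ / (csrt k x).
Qed.

Lemma range_pull L (M : structure L) (X X' : ctx L) (u : tup X M)
    (v : tup X' M) :
  range_of u `<=` range_of v -> exists k : cmap X X', u = pull k v.
Proof.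
move=> sub.
have elE (y : X') (p : elt M) : el v y = p ->
    exists e : srt y = projT1 p, projT2 p = ecast s (M s) e (v y).
  by case: _ /; exists erefl.
have /dchoice[f /dchoice[e H]] x :
    exists (y : X') (e : srt y = srt x), u x = ecast s (M s) e (v y).
  have /sub[y /elE[e ue]] : range_of u (el u x) by exists x.
  by exists y, e.
exists (CMap e); exact: functional_extensionality_dep.
Qed.

Lemma range_of_cat L (M : structure L) (X Y : ctx L) (a : tup X M)
    (b : tup Y M) : range_of (tcat a b) = range_of a `|` range_of b.
Proof.
apply/seteqP; split=> e; first by move=> [[x|y] <-]; [left; exists x|right; exists y].
by move=> [[x <-]|[y <-]]; [exists (inl x)|exists (inr y)].
Qed.

Lemma range_of_tset L (M : structure L) (B : set (elt M)) :
  range_of (@tset L M B) = B.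
Proof.
apply/seteqP; split=> [_ [[[s m] Be] <-]//|[s m] Be].
by exists (exist _ (existT _ s m) Be).
Qed.

Lemma range_of_tmap L (C N : structure L) (h : forall s, C s -> N s)
    (X : ctx L) (a : tup X C) : range_of (tmap h a) = emap h @` range_of a.
Proof.
apply/seteqP; split=> [_ [x <-]|_ [_ [x <-] <-]]; last by exists x.
by exists (el a x) => //; exists x.
Qed.

(** Equality of types over the parameters [z], with all of [z] in the context instead of a finite
    part of it; unlike equality of [tp], it applies directly to definable predicates. *)
Definition teq L (M : structure L) (Z X : ctx L) (z : tup Z M)
    (a a' : tup X M) :=
  forall phi : formula (csum Z X), sat phi (tcat z a) <-> sat phi (tcat z a').

Lemma def_teq L (M : structure L) (Z X : ctx L) (z : tup Z M)
    (a a' : tup X M) (D : forall M : structure L, tup (csum Z X) M -> Prop) :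
  teq z a a' -> definable D -> D M (tcat z a) <-> D M (tcat z a').
Proof. by move=> H [phi Hphi]; rewrite -!Hphi. Qed.

Lemma natural_swap L (X Y : ctx L) :
  natural (fun M (a : tup (csum X Y) M) => tcat (tsnd a) (tfst a)).
Proof. prove_natural. Qed.

Lemma tp_teq L (M : structure L) (A : set (elt M)) (Z X : ctx L)
    (z : tup Z M) (a a' : tup X M) :
  range_of z `<=` A -> tp a A = tp a' A -> teq z a a'.
Proof.
move=> zA E phi.
have [k Hk] := natural_cmap (@natural_swap L X Z).
have [V [g [phi' [_ H]]]] := fin_par (fml_ren k phi).
have {}H b : sat phi (tcat z b) <-> psat (PFml phi' (pull g z)) b.
  by rewrite /psat /= -H sat_ren -Hk.
have pA : pover A (PFml phi' (pull g z) : pfml M X).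
  exact: subset_trans (@range_of_pull _ _ _ _ g z) zA.
have {}E : tp a A (PFml phi' (pull g z)) <-> tp a' A (PFml phi' (pull g z)).
  by rewrite E.
by rewrite !H; split=> S; [have [] := E.1 (conj pA S)|have [] := E.2 (conj pA S)].
Qed.

Lemma teq_psat L (M : structure L) (Z X : ctx L)
    (z : tup Z M) (a a' : tup X M) (psi : pfml M X) :
  range_of (par psi) `<=` range_of z -> teq z a a' -> psat psi a -> psat psi a'.
Proof.
case: psi => V psi c /= /range_pull[k ->] H; rewrite /psat /=.
have dD : definable (fun M (b : tup (csum Z X) M) =>
    sat psi (tcat (tsnd b) (pull k (tfst b)))) by apply: def_sat; prove_natural.
exact: (def_teq H dD).1.
Qed.

Lemma teq_sym L (M : structure L) (Z X : ctx L) (z : tup Z M)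
    (a a' : tup X M) : teq z a a' -> teq z a' a.
Proof. by move=> H phi; rewrite H. Qed.

Lemma teq_tp L (M : structure L) (A : set (elt M)) (Z X : ctx L)
    (z : tup Z M) (a a' : tup X M) :
  A `<=` range_of z -> teq z a a' -> tp a A = tp a' A.
Proof.
move=> Az H; apply/seteqP; split=> psi [/= cA S]; split=> //; apply: teq_psat S.
- exact: subset_trans cA Az.
- exact: H.
- exact: subset_trans cA Az.
- exact: teq_sym.
Qed.

Lemma teq_pull L (M : structure L) (Z X Y : ctx L) (z : tup Z M)
    (a a' : tup X M) (k : cmap Y X) : teq z a a' -> teq z (pull k a) (pull k a').
Proof.
move=> H phi.
have dD : definable (fun M (b : tup (csum Z X) M) =>
    sat phi (tcat (tfst b) (pull k (tsnd b)))) by apply: def_sat; prove_natural.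
exact: (def_teq H dD).
Qed.

(* The hypothesis on [u_] is that of an [A']-indiscernible sequence without
   the indiscernibility, so a finite subset of the indices has to be chosen. *)
Lemma nondividing_par L (M : structure L) (X W Z : ctx L) (A' B' : set (elt M))
    (z : tup Z M) (x : tup X M) (w : formula (csum X W)) (u : tup W M)
    (u_ : nat -> tup W M) :
  ~ tp_divides A' (tp x B') -> A' `<=` range_of z -> range_of u `<=` B' ->
  sat w (tcat x u) -> (forall j, teq z (u_ j) u) ->
  forall K, exists J : seq nat, [/\ uniq J, size J = K &
    exists y : tup X M, forall j, j \in J -> sat w (tcat y (u_ j))].
Proof.
move=> ndiv A'z uB' wxu uu K; apply: contrapT => nJ; apply: ndiv.
have [V [g [w' [_ H]]]] := fin_par w.
exists (PFml w' (pull g u)); split.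
  split; last by rewrite /psat /= -H.
  exact: subset_trans (@range_of_pull _ _ _ _ g u) uB'.
exists K, (fun j => pull g (u_ j)); split=> [j|J uJ sJ [y Hy]].
  by apply: teq_tp A'z _; apply: teq_pull.
by apply: nJ; exists J; split=> //; exists y => j /Hy; rewrite /= -H.
Qed.

Lemma card_lt_le (U V W : Type) (A : set U) (B : set V) (K : set W) :
  A #<= B -> card_lt B K -> card_lt A K.
Proof.
move=> AB [BK nKB]; split; first exact: card_le_trans AB BK.
by move=> KA; apply: nKB; apply: card_le_trans KA AB.
Qed.

(** [C] is small for [N], so saturation realizes the global type in [N]; both nondividing clauses
    come from strictness at this realization. *)
Lemma strictly_free_realized L (kappa' : Type) (C N : structure L)
    (h : forall s, C s -> N s) (X : fctx L) (A : set (elt C))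
    (p : set (pfml C X)) :
  saturated kappa' N -> card_lt [set: elt C] [set: kappa'] ->
  strictly_free h A p ->
  exists a : tup X N,
    [/\ forall psi, p psi -> psat (pmap_par h psi) a,
        ~ tp_divides (emap h @` A) (tp a (range (emap h)))
      & ~ tp_divides (emap h @` A)
          (tp (@tset L N (range (emap h))) (emap h @` A `|` range_of a))].
Proof.
move=> satN smallC [q [_ pq [_ [qB qc _] qnd]]].
have [|a Ha] := satN X _ _ _ qB qc.
  by apply: card_lt_le smallC; exact: card_image_le.
have [nd1 nd2] := qnd a Ha; exists a; split=> // psi /pq qpsi.
by apply: Ha; exists psi.
Qed.

Lemma divides_teq L (M : structure L) (A : set (elt M)) (X : ctx L)
    (psi : pfml M X) :
  divides A psi -> exists (k : nat) (c : nat -> tup (pctx psi) M),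
    (forall j, teq (@tset L M A) (c j) (par psi)) /\
    forall J : seq nat, uniq J -> size J = k ->
      ~ exists x : tup X M,
          forall j, j \in J -> sat (pform psi) (tcat x (c j)).
Proof.
move=> [k [c [ctp kinc]]]; exists k, c; split=> // j.
by apply: tp_teq (ctp j); rewrite range_of_tset.
Qed.

(** * Countable limits in saturated structures *)

Lemma card_le_inj (T U : Type) (A : set T) (B : set U) :
  A #<= B -> exists f : forall x, A x -> U,
    (forall x Ax, B (f x Ax)) /\ forall x y Ax Ay, f x Ax = f y Ay -> x = y.
Proof.
move=> /card_leP/unsquash f.
exists (fun x Ax => val (f (exist _ x (mem_set Ax)))).
split=> [x Ax|x y Ax Ay /val_inj E]; first exact: set_valP.
have := @inj _ _ _ f (exist _ x (mem_set Ax)) (exist _ y (mem_set Ay)) _ _ E.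
by rewrite !in_setT => /(_ isT isT) [].
Qed.

Lemma fun_card_le (T U : Type) (A : set T) (B : set U) (f : T -> U) :
  (forall x, A x -> B (f x)) ->
  (forall x y, A x -> A y -> f x = f y -> x = y) -> A #<= B.
Proof.
move=> fB fI; have /injfunPex[g] : exists2 f : T -> U, set_fun A B f & set_inj A f.
  by exists f => // x y; rewrite !inE; exact: fI.
exact: inj_card_le g.
Qed.

(** Hilbert's hotel: [x] takes the first place of a copy [g] of the naturals inside [A], whose
    members move one place up. *)
Lemma card_setU1_infinite (T : Type) (A : set T) (x : T) :
  infinite_set A -> A `|` [set x] #<= A.
Proof.
have [Ax|nAx] := pselect (A x).
  by move=> _; apply: subset_card_le => y [|->].
move=> /infiniteP/card_le_inj[g0 [gA gI]].
pose g n := g0 n I; have {}gI n m : g n = g m -> n = m by exact: gI.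
pose f y := if pselect (y = x) is left _ then g 0
  else if pselect (exists n, g n = y) is left H then g (sval (cid H)).+1 else y.
apply: (@fun_card_le _ _ _ _ f) => [y Hy|y y' Hy Hy'].
  rewrite /f; case: pselect => [_|yx]; first exact: gA.
  by case: pselect => [H|_]; [exact: gA|case: Hy].
rewrite /f; case: (pselect (y = x)) => [->|yx];
  case: (pselect (y' = x)) => [->|yx'] //.
- case: pselect => [H /gI//|H E]; by case: H; exists 0.
- case: pselect => [H /gI//|H E]; by case: H; exists 0.
case: pselect => [H|H]; case: pselect => [H'|H'] //.
- by move=> /gI [E]; rewrite -(svalP (cid H)) -(svalP (cid H')) E.
- by move=> E; case: H'; exists (sval (cid H)).+1.
- by move=> E; case: H; exists (sval (cid H')).+1.
Qed.

Lemma finite_ind (T : Type) (P : set T -> Prop) :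
  P set0 -> (forall A x, P A -> P (A `|` [set x])) ->
  forall A, finite_set A -> P A.
Proof.
move=> P0 PU A; pose A' : set {classic T} := A => /(@finite_seqP _ A')[s].
rewrite /A' => ->; elim/last_ind: s => [|s x IH].
  by rewrite (_ : [set` [::]] = set0) //; apply/seteqP; split.
rewrite (_ : [set` rcons s x] = [set` s] `|` [set x]); first exact: PU.
apply/seteqP; split=> y; rewrite /= mem_rcons inE.
  by case/orP=> [/eqP->|]; [right|left].
by case=> [->|->]; rewrite ?eqxx ?orbT.
Qed.

Lemma card_lt_setU (T K : Type) (A F : set T) :
  [set: nat] #<= [set: K] -> card_lt A [set: K] -> finite_set F ->
  card_lt (A `|` F) [set: K].
Proof.
move=> natK AK; have [fA fF|iA] := pselect (finite_set A).
  have fAF : finite_set (A `|` F) by rewrite finite_setU.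
  split; first exact: card_le_trans (finite_set_countable fAF) natK.
  by move=> KA; move/finite_setPn: fAF; apply; exact: card_le_trans natK KA.
move: F; apply: finite_ind => [|F x IH]; first by rewrite setU0.
rewrite setUA; apply: card_lt_le IH; apply: card_setU1_infinite.
by apply: contra_not iA; apply: sub_finite_set; exact: subsetUl.
Qed.

Definition below L (X : ctx L) (r : X -> nat) (n : nat) : ctx L :=
  @Ctx L {x : X | r x < n} (fun x => srt (sval x)).

Definition restr L (X : ctx L) (r : X -> nat) n (M : structure L)
    (t : tup X M) : tup (below r n) M := fun x => t (sval x).

Arguments restr {L X} r n {M} t.

Lemma restr_cmap_new L (Z X : ctx L) (r : X -> nat) n (x0 : X) :
  injective r -> r x0 = n ->
  exists k : cmap (csum Z (below r n.+1)) (csum (csingle (srt x0)) (csum Z (below r n))),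
  forall M (t : tup Z M * tup X M),
    tcat t.1 (restr r n.+1 t.2) =
    pull k (tcat (tsingle (t.2 x0)) (tcat t.1 (restr r n t.2))).
Proof.
move=> rI rx0; apply: cmap_choice => -[z|[x xn]].
  by exists (inr (inl z)), erefl.
have [e|xx0] := pselect (x0 = x).
  by case: _ / e xn => xn; exists (inl ord0), erefl.
have xn' : r x < n.
  by rewrite ltn_neqAle -ltnS xn andbT; apply/eqP => rx; apply: xx0; apply: rI; rewrite rx.
by exists (inr (inr (exist _ x xn'))), erefl.
Qed.

Lemma restr_cmap_old L (Z X : ctx L) (r : X -> nat) n :
  ~ (exists x0, r x0 = n) ->
  exists k : cmap (csum Z (below r n.+1)) (csum Z (below r n)),
  forall M (t : tup Z M * tup X M),
    tcat t.1 (restr r n.+1 t.2) = pull k (tcat t.1 (restr r n t.2)).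
Proof.
move=> nx0; apply: cmap_choice => -[z|[x xn]]; first by exists (inl z), erefl.
have xn' : r x < n.
  by rewrite ltn_neqAle -ltnS xn andbT; apply/eqP => rx; apply: nx0; exists x.
by exists (inr (exist _ x xn')), erefl.
Qed.

Lemma finite_below L (M : structure L) (X : ctx L) (r : X -> nat) n
    (t : tup X M) : injective r -> finite_set (range_of (restr r n t)).
Proof.
move=> rI; apply: (@card_le_finite _ _ _ [set x | r x < n] _ _).
  apply: card_le_trans (card_image_le (el t) _).
  by apply: subset_card_le => _ [[x xn] <-]; exists x.
apply: card_le_finite (finite_II n).
by apply: (@fun_card_le _ _ _ _ r) => // x y _ _; exact: rI.
Qed.

Section Ultralimit.
Variables (L : language) (kappa : Type) (C M' : structure L) (Z X : ctx L).
Variables (z : tup Z C) (z' : tup Z M') (r : X -> nat).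
Variables (I : Type) (U : set_system I) (v_ : I -> tup X M').
Hypotheses (satC : saturated kappa C) (kappa_inf : [set: nat] #<= [set: kappa]).
Hypotheses (z_small : card_lt (range_of z) [set: kappa]) (rI : injective r).
Hypotheses (UU : UltraFilter U) (zz' : forall phi, sat phi z' -> sat phi z).

Let good n (v : tup X C) := forall phi : formula (csum Z (below r n)),
  U [set i | sat phi (tcat z' (restr r n (v_ i)))] -> sat phi (tcat z (restr r n v)).

Lemma def_good n v (D : forall M : structure L, tup (csum Z (below r n)) M -> Prop) :
  good n v -> definable D -> U [set i | D M' (tcat z' (restr r n (v_ i)))] ->
  D C (tcat z (restr r n v)).
Proof.
move=> gv [phi H]; rewrite -H => UD; apply: gv; apply: filterS UD => i /=.
by rewrite H.
Qed.

Lemma good0 : exists v, good 0 v.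
Proof.
(* The sorts of [X] must be inhabited in [C]; they are in [M'], and nonemptiness of a sort is a
   formula true of [z']. *)
have Hv (x : X) : exists m : C (srt x), m = m.
  have [phi Hphi] := def_ex1 (def_true (cext Z (srt x))).
  suff /Hphi[m _] : sat phi z by exists m.
  apply: zz'; apply/Hphi; have [i _] := filter_ex (@filterT _ U _).
  by exists (v_ i x).
have [v _] := dchoice Hv; exists v => phi /filter_ex[i /=].
have [k Hk] : exists k : cmap (csum Z (below r 0)) Z,
    forall M (t : tup Z M * tup X M), tcat t.1 (restr r 0 t.2) = pull k t.1.
  by apply: cmap_choice => -[x|[x]//]; exists x, erefl.
by rewrite (Hk M' (z', v_ i)) (Hk C (z, v)) -!sat_ren; exact: zz'.
Qed.

(** A finite part of the average type of the new coordinate follows from one formula true [U]-almost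
    everywhere; its existential closure concerns the earlier coordinates only and passes to [C] by
    [good]. Saturation in one variable does the rest. *)
Lemma good_step n v : good n v -> exists v',
  (forall x, r x < n -> v' x = v x) /\ good n.+1 v'.
Proof.
move=> gv; have [[x0 rx0]|nx0] := pselect (exists x0, r x0 = n); last first.
  have [k Hk] := restr_cmap_old Z nx0.
  exists v; split=> // phi; rewrite (Hk C (z, v)) => Uphi.
  apply: (def_good (D := fun M a => sat phi (pull k a)) gv).
    by apply: def_sat; prove_natural.
  by apply: filterS Uphi => i /=; rewrite (Hk M' (z', v_ i)).
have [k Hk] := restr_cmap_new Z rI rx0.
pose S := csingle (srt x0).
pose B := range_of z `|` range_of (restr r n v).
(* [w] ties [psi], whose parameters lie in [C], to a formula on [z] and the earlier coordinates,
   which can be evaluated in [M']. *)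
pose p : set (pfml C S) := [set psi | pover B psi /\
  exists w : formula (csum S (csum Z (below r n))),
    U [set i | sat w (tcat (tsingle (v_ i x0)) (tcat z' (restr r n (v_ i))))] /\
    forall y, psat psi y <-> sat w (tcat y (tcat z (restr r n v)))].
have [m Hm] : exists m : tup S C, realizes p m.
  apply: (satC (B := B)).
  - exact: card_lt_setU kappa_inf z_small (finite_below _ _ rI).
  - by move=> psi [].
  move=> F fF Fp.
  have [w [Uw Hw]] : exists w : formula (csum S (csum Z (below r n))),
      U [set i | sat w (tcat (tsingle (v_ i x0)) (tcat z' (restr r n (v_ i))))] /\
      forall y psi, F psi -> sat w (tcat y (tcat z (restr r n v))) -> psat psi y.
    move: F fF Fp; apply: finite_ind => [_|F psi IH Fp].
      exists (Neg Fls); split=> //=; apply: filterS filterT => i _ /=; exact: id.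
    have [w [Uw Hw]] := IH (fun psi Fpsi => Fp psi (or_introl Fpsi)).
    have [_ [w' [Uw' Hw']]] := Fp psi (or_intror erefl).
    have [w'' Hw''] := def_and (def_sat w (@natural_id _ _)) (def_sat w' (@natural_id _ _)).
    exists w''; split.
      by apply: filterS (filterI Uw Uw') => i [? ?] /=; apply/Hw''.
    by move=> y psi' [Fpsi|->] /Hw''[wy w'y]; [apply: Hw|apply/Hw'].
  have [y Hy] : exists y : tup S C, sat w (tcat y (tcat z (restr r n v))).
    have dD : definable (fun M (a : tup (csum Z (below r n)) M) =>
        exists y : tup S M, sat w (tcat (tsnd (tcat a y)) (tfst (tcat a y)))).
      apply: (def_ex (D := fun M b => sat w (tcat (tsnd b) (tfst b)))).
      by apply: def_sat; prove_natural.
    apply: (def_good gv dD); apply: filterS Uw => i /= Hi.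
    by exists (tsingle (v_ i x0)).
  by exists y => psi Fpsi; apply: Hw Hy.
have /dchoice[v' Hv'] (x : X) : exists m' : C (srt x),
    (r x < n -> m' = v x) /\ (forall e : x0 = x, m' = ecast x (C (srt x)) e (m ord0)).
  have [<-|xx0] := pselect (x0 = x).
    by exists (m ord0); split=> [|e]; rewrite ?rx0 ?ltnn // (Prop_irrelevance e erefl).
  by exists (v x); split.
have v'n : restr r n v' = restr r n v.
  by apply: functional_extensionality_dep => -[x xn]; rewrite /restr /= (Hv' x).1.
have v'x0 : tsingle (v' x0) = m.
  apply: functional_extensionality_dep => i; rewrite /tsingle (Hv' x0).2 //=.
  by rewrite (ord1 i).
exists v'; split=> [x /(Hv' x).1//|phi Uphi].
have [W [g [w' [_ Hw']]]] := fin_par (fml_ren k phi).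
have /Hm : p (PFml w' (pull g (tcat z (restr r n v)))).
  split.
    by apply: subset_trans (@range_of_pull _ _ _ _ g _) _; rewrite range_of_cat.
  exists (fml_ren k phi); split=> [|y]; last by rewrite /psat /= -Hw'.
  by apply: filterS Uphi => i /=; rewrite sat_ren (Hk M' (z', v_ i)).
by rewrite /psat /= -Hw' sat_ren (Hk C (z, v')) /= v'n v'x0.
Qed.

(** Coordinates are fixed one after another in the order of their rank; a formula reads finitely
    many of them, so it is decided at a finite stage. *)
Lemma ultra_limit : exists v : tup X C, forall phi : formula (csum Z X),
  U [set i | sat phi (tcat z' (v_ i))] -> sat phi (tcat z v).
Proof.
have [v0 gv0] := good0.
have /choice[f Hf] : forall nv : nat * tup X C, exists v', good nv.1 nv.2 ->
    (forall x, r x < nv.1 -> v' x = nv.2 x) /\ good nv.1.+1 v'.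
  move=> [n v]; have [/good_step[v' ?]|ngv] := pselect (good n v).
    by exists v'.
  by exists v.
pose s := fix s n := if n is n'.+1 then f (n', s n') else v0.
have gs n : good n (s n) by elim: n => // n IH; have [] := Hf (n, s n) IH.
(* Coordinate [x] is settled at stage [(r x).+1] and never changes afterwards. *)
pose v x := s (r x).+1 x.
have sv m n x : r x < n -> s (n + m) x = s n x.
  move=> xn; elim: m => [|m IH]; first by rewrite addn0.
  rewrite addnS -IH /=; have [-> //] := Hf (n + m, s (n + m)) (gs _).
  exact: leq_trans xn (leq_addr _ _).
have rv n : restr r n v = restr r n (s n).
  apply: functional_extensionality_dep => -[x xn]; rewrite /restr /= /v.
  by rewrite -(sv (n - (r x).+1) (r x).+1 x (ltnSn _)) subnKC.
exists v => phi Uphi.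
have [V [g [phi' [_ H]]]] := fin_par phi.
pose n := (\max_(i : V) r (g i)).+1.
have Vn i : r (g i) < n by rewrite ltnS (leq_bigmax (F := fun i => r (g i))).
have [k Hk] : exists k : cmap (csum Z V) (csum Z (below r n)),
    forall M (t : tup Z M * tup X M),
    tcat t.1 (pull g t.2) = pull k (tcat t.1 (restr r n t.2)).
  apply: cmap_choice => -[x|i]; first by exists (inl x), erefl.
  by exists (inr (exist _ (g i) (Vn i))), (csrt g i).
rewrite H (Hk C (z, v)) -sat_ren rv; apply: gs.
by apply: filterS Uphi => i /=; rewrite H (Hk M' (z', v_ i)) sat_ren.
Qed.

End Ultralimit.

(** Compactness for countably many variables, across two structures: an ultrafilter refining [F]
    completes the conditions to a type. *)
Lemma filter_limit L (kappa : Type) (C M' : structure L) (Z X : ctx L)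
    (z : tup Z C) (z' : tup Z M') (r : X -> nat) (I : Type)
    (F : set_system I) (v_ : I -> tup X M') :
  saturated kappa C -> [set: nat] #<= [set: kappa] ->
  card_lt (range_of z) [set: kappa] -> injective r -> ProperFilter F ->
  (forall phi, sat phi z' -> sat phi z) ->
  exists v : tup X C,
    forall D : forall M : structure L, tup (csum Z X) M -> Prop,
    definable D -> F [set i | D M' (tcat z' (v_ i))] -> D C (tcat z v).
Proof.
move=> satC kinf zs rI FF zz'.
have [U [UU FU]] := ultraFilterLemma FF.
have [v Hv] := ultra_limit v_ satC kinf zs rI UU zz'.
exists v => D [phi H] FD; apply/H/Hv; apply: FU; apply: filterS FD => i /=.
by rewrite H.
Qed.

(** * Iterated ultrafilter quantifiers and mutually indiscernible arrays *)

Definition scons (T : Type) (x : T) (s : nat -> T) (n : nat) : T :=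
  if n is n'.+1 then s n' else x.

Definition incr (t : nat -> nat) := forall i j, i < j -> t i < t j.

Definition incr_upto (m : nat) (t : nat -> nat) :=
  forall i j, i < j < m -> t i < t j.

(* [iter_seq U m] quantifies the first [m] terms of the sequence by [U], the
   first one outermost; [iter_rows U n m] does so for [n] rows in turn. *)
Fixpoint iter_seq (U : set_system nat) (m : nat) (P : set (nat -> nat)) : Prop :=
  if m is m'.+1 then U [set j | iter_seq U m' [set s | P (scons j s)]]
  else P (fun=> 0).

Fixpoint iter_rows (U : set_system nat) (n m : nat)
    (P : set (nat -> nat -> nat)) : Prop :=
  if n is n'.+1 then
    iter_seq U m [set s0 | iter_rows U n' m [set s | P (scons s0 s)]]
  else P (fun _ _ => 0).

Definition depends_on (m : nat) (P : set (nat -> nat)) :=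
  forall s s', (forall l, l < m -> s l = s' l) -> P s -> P s'.

Definition depends_on_rows (n m : nat) (P : set (nat -> nat -> nat)) :=
  forall s s', (forall i l, i < n -> l < m -> s i l = s' i l) -> P s -> P s'.

Section Iterated.
Variable U : set_system nat.
Hypothesis UU : UltraFilter U.

Lemma iter_seq_filter m : ProperFilter (iter_seq U m).
Proof.
elim: m => [|m IH]; split=> /=.
- by [].
- by split=> [|P Q HP HQ|P Q sPQ]; [exact: I|split|exact: sPQ].
- rewrite (_ : [set j | _] = set0); first exact: filter_not_empty.
  apply/seteqP; split=> // j /=.
  by rewrite (_ : [set s | _] = set0) //; exact: filter_not_empty.
split=> /=.
- by apply: filterS filterT => j _ /=; exact: filterT.
- by move=> P Q /filterI H /H; apply: filterS => j [] /=; exact: filterI.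
by move=> P Q sPQ; apply: filterS => j /=; apply: filterS => s; exact: sPQ.
Qed.

Lemma iter_seq_ultra m P : iter_seq U m P \/ iter_seq U m (~` P).
Proof.
elim: m P => [|m IH] P /=; first exact: EM.
have [?|H] := in_ultra_setVsetC [set j | iter_seq U m [set s | P (scons j s)]] UU.
  by left.
by right; apply: filterS H => j /=; have [|//] := IH [set s | P (scons j s)].
Qed.

Lemma iter_seq_const m (P : set (nat -> nat)) s :
  depends_on 0 P -> iter_seq U m P <-> P s.
Proof.
move=> dP; have PE s' : P s' <-> P s by split; exact: dP.
split=> [H|Ps].
  by have [s' /PE] := @filter_ex _ _ (iter_seq_filter m) _ H.
have [//|H] := iter_seq_ultra m P.
by have [s'] := @filter_ex _ _ (iter_seq_filter m) _ H; rewrite /setC /= PE.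
Qed.

Lemma iter_seq_ext m (P Q : set (nat -> nat)) :
  (forall s, P s <-> Q s) -> iter_seq U m P <-> iter_seq U m Q.
Proof. by move=> H; rewrite (_ : P = Q) //; apply/seteqP; split=> s /H. Qed.

Lemma iter_rows_ext n m (P Q : set (nat -> nat -> nat)) :
  (forall s, P s <-> Q s) -> iter_rows U n m P <-> iter_rows U n m Q.
Proof. by move=> H; rewrite (_ : P = Q) //; apply/seteqP; split=> s /H. Qed.

(** A quantifier over a position that [P] does not read is vacuous, so only the number and the order
    of the positions read matter. This is the source of indiscernibility. *)
Lemma iter_seq_shift K m (t : nat -> nat) P :
  incr t -> depends_on m P -> (forall l, l < m -> t l < K) ->
  iter_seq U K [set s : nat -> nat | P (s \o t)] <-> iter_seq U m P.
Proof.
elim: K m t P => [|K IH] [|m] t P ti dP tK.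
- by split=> /= H; apply: dP H.
- by have := tK 0 isT.
- rewrite (iter_seq_const K.+1 (fun=> 0)); first by split=> H; apply: dP H.
  by move=> s s' _; exact: dP.
rewrite /=; set A := [set j | _]; set B := [set j | _].
(* If [t 0] is zero, the outermost quantifier binds the first term read by [P]; otherwise it is
   vacuous. *)
case t0 : (t 0) => [|b].
  suff -> : A = B by [].
  rewrite /A /B predeqE => j /=.
  pose t' l := (t l.+1).-1.
  have t'E l : t l.+1 = (t' l).+1.
    by rewrite /t' prednK //; apply: leq_ltn_trans (ti 0 l.+1 isT).
  rewrite -(IH m t').
  - apply: iter_seq_ext => s /=.
    suff -> : scons j s \o t = scons j (s \o t') by [].
    by apply/funext => -[|l] /=; rewrite ?t0 ?t'E.
  - by move=> l l' ll'; have := ti l.+1 l'.+1 ll'; rewrite !t'E.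
  - by move=> s s' ss' /=; apply: dP => -[|l] //=; rewrite ltnS; exact: ss'.
  by move=> l lm; have := tK l.+1 lm; rewrite t'E.
pose t' l := (t l).-1.
have t'E l : t l = (t' l).+1.
  rewrite /t' prednK //; case: l => [|l]; first by rewrite t0.
  by apply: leq_ltn_trans (ti 0 l.+1 isT).
have AE : A = [set j | iter_seq U K [set s : nat -> nat | P (s \o t')]].
  rewrite predeqE => j /=; apply: iter_seq_ext => s /=.
  by suff -> : scons j s \o t = s \o t' by []; apply/funext => l /=; rewrite t'E.
rewrite AE; have IH' : iter_seq U K [set s : nat -> nat | P (s \o t')] <-> iter_seq U m.+1 P.
  apply: IH => //.
    by move=> l l' ll'; have := ti l l' ll'; rewrite !t'E.
  by move=> l lm; have := tK l lm; rewrite t'E.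
apply: iff_trans IH'.
split=> H; first by have /filter_ex[] := H.
by apply: filterS filterT.
Qed.

Lemma iter_rows_filter n m : ProperFilter (iter_rows U n m).
Proof.
have FS := iter_seq_filter m.
elim: n => [|n IH]; split=> /=.
- by [].
- by split=> [|P Q HP HQ|P Q sPQ]; [exact: I|split|exact: sPQ].
- rewrite (_ : [set s0 | _] = set0); first exact: filter_not_empty.
  apply/seteqP; split=> // j /=.
  by rewrite (_ : [set s | _] = set0) //; exact: filter_not_empty.
split=> /=.
- by apply: filterS filterT => j _ /=; exact: filterT.
- by move=> P Q /filterI H /H; apply: filterS => j [] /=; exact: filterI.
by move=> P Q sPQ; apply: filterS => j /=; apply: filterS => s; exact: sPQ.
Qed.

Lemma iter_rows_ultra n m P : iter_rows U n m P \/ iter_rows U n m (~` P).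
Proof.
have FS := iter_seq_filter m.
elim: n P => [|n IH] P /=; first exact: EM.
have [?|H] := iter_seq_ultra m [set s0 | iter_rows U n m [set s | P (scons s0 s)]].
  by left.
by right; apply: filterS H => j /=; have [|//] := IH [set s | P (scons j s)].
Qed.

Lemma iter_rows_shift n K m (t : nat -> nat -> nat) P :
  (forall i, incr (t i)) -> depends_on_rows n m P ->
  (forall i l, i < n -> l < m -> t i l < K) ->
  iter_rows U n K [set s : nat -> nat -> nat | P (fun i => s i \o t i)] <-> iter_rows U n m P.
Proof.
have FR := iter_rows_filter.
elim: n t P => [|n IH] t P ti dP tK //=.
rewrite -(@iter_seq_shift K m (t 0)) //; last 2 first.
- move=> s s' ss'; apply: filterS => u; apply: dP => -[|i] l //= _; exact: ss'.
- by move=> l; exact: tK.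
apply: iter_seq_ext => s0 /=.
rewrite -(IH (fun i => t i.+1)) //; last first.
- by move=> i l; exact: (tK i.+1).
- by move=> s s' ss'; apply: dP => -[|i] l //=; rewrite ltnS; exact: ss'.
apply: iter_rows_ext => s /=.
suff -> : (fun i => scons s0 s i \o t i) = scons (s0 \o t 0) (fun i => s i \o t i.+1) by [].
by apply/funext => -[].
Qed.

Hypothesis U_free : forall b, U [set j | b < j].

Lemma iter_seq_incr m : iter_seq U m [set s | incr_upto m s].
Proof.
have FS := iter_seq_filter.
(* The bound [b] carries the index chosen just before into the induction. *)
suff: forall b, iter_seq U m [set s | incr_upto m s /\ forall l, l < m -> b < s l].
  by move=> /(_ 0); apply: filterS => s [].
elim: m => [|m IH] b /=.
  by split=> // i j /andP[].
apply: filterS (U_free b) => j bj; apply: filterS (IH j) => s [si js] /=.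
split=> [[|i] [|i'] //|[|l] //= lm].
- by rewrite ltnS => im; exact: js.
- exact: si.
- by apply: ltn_trans bj _; exact: js.
Qed.

Lemma iter_rows_incr n m :
  iter_rows U n m [set s | forall i, i < n -> incr_upto m (s i)].
Proof.
have FS := iter_seq_filter; have FR := iter_rows_filter.
elim: n => [|n IH] //=; apply: filterS (iter_seq_incr m) => s0 s0i /=.
by apply: filterS IH => s si [|i] //=; exact: si.
Qed.

(** [iter_rows] replaces the columns from [m] on by the index [0], so for an array with infinitely
    many columns only its values for large [m] are meaningful. *)
Definition iter_limit n : set_system (nat -> nat -> nat) :=
  [set P | exists m0, forall m, m0 <= m -> iter_rows U n m P].

Lemma iter_limit_filter n : ProperFilter (iter_limit n).
Proof.
have FR := iter_rows_filter n.
split=> [[m0 /(_ m0 (leqnn _))]|]; first exact: filter_not_empty.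
split=> [|P Q [m0 H0] [m1 H1]|P Q sPQ [m0 H0]].
- by exists 0 => m _; exact: filterT.
- exists (maxn m0 m1) => m; rewrite geq_max => /andP[/H0 ? /H1 ?].
  exact: filterI.
by exists m0 => m /H0; exact: filterS.
Qed.

Lemma iter_limit_incr n m :
  iter_limit n [set s | forall i, i < n -> incr_upto m (s i)].
Proof.
have FR := iter_rows_filter n.
exists m => K mK; apply: filterS (iter_rows_incr n K) => s si i /si H l l'.
by move=> /andP[ll' lm]; apply: H; rewrite ll' (leq_trans lm).
Qed.

(** The iterated quantifiers decide [P], and by [iter_rows_shift] they decide its reindexing in the
    same way; hence both have the same truth value almost everywhere. *)
Lemma iter_limit_shift n m P (t : nat -> nat -> nat) :
  (forall i, incr (t i)) -> depends_on_rows n m P ->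
  iter_limit n [set s : nat -> nat -> nat | P s <-> P (fun i => s i \o t i)].
Proof.
move=> ti dP; have FR := iter_rows_filter n.
pose K := (\max_(i < n) \max_(l < m) (t i l).+1 + m)%N.
have tK i l : i < n -> l < m -> t i l < K.
  move=> i_n l_m; apply: leq_trans (leq_addr _ _).
  apply: leq_trans (leq_bigmax (F := fun i : 'I_n => \max_(l < m) (t i l).+1) (Ordinal i_n)).
  exact: leq_trans (leq_bigmax (F := fun l : 'I_m => (t i l).+1) (Ordinal l_m)).
exists K => K' KK'.
have tK' i l : i < n -> l < m -> t i l < K'.
  by move=> ? ?; apply: leq_trans KK'; exact: tK.
have mK' i l : i < n -> l < m -> l < K'.
  by move=> _ lm; apply: leq_trans lm (leq_trans (leq_addl _ _) KK').
have E1 := iter_rows_shift ti dP tK'.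
have E2 : iter_rows U n K' P <-> iter_rows U n m P.
  exact: (iter_rows_shift (t := fun _ => id) (fun _ _ _ ij => ij) dP mK').
have dN : depends_on_rows n m (~` P).
  by move=> s s' ss'; apply: contra_not; apply: dP => i l ? ?; rewrite ss'.
have E3 := iter_rows_shift ti dN tK'.
have E4 : iter_rows U n K' (~` P) <-> iter_rows U n m (~` P).
  exact: (iter_rows_shift (t := fun _ => id) (fun _ _ _ ij => ij) dN mK').
have [H|H] := iter_rows_ultra n m P.
  by apply: filterS (filterI (E2.2 H) (E1.2 H)) => s [].
by apply: filterS (filterI (E4.2 H) (E3.2 H)) => s [].
Qed.

End Iterated.

(** * Arrays with countably many rows and columns, as tuples in one context *)

Definition cells L (P : nat -> fctx L) : ctx L :=
  @Ctx L {i : nat & (nat * P i)%type} (fun v => srt (projT2 v).2).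

Definition cell L (P : nat -> fctx L) (M : structure L) (y : tup (cells P) M)
    i j : tup (P i) M :=
  fun x => y (existT _ i (j, x)).
Arguments cell {L P M} y i j x.

Definition recol L (P : nat -> fctx L) (t : nat -> nat -> nat)
    (M : structure L) (y : tup (cells P) M) : tup (cells P) M :=
  fun v => y (existT _ (projT1 v) (t (projT1 v) (projT2 v).1, (projT2 v).2)).

Fixpoint rows L (P : nat -> fctx L) (n : nat) : ctx L :=
  if n is n'.+1 then csum (rows P n') (P n') else cnil L.

Fixpoint col L (P : nat -> fctx L) (M : structure L)
    (d : forall i, tup (P i) M) (n : nat) : tup (rows P n) M :=
  match n return tup (rows P n) M with
  | 0 => @tnil L M
  | n'.+1 => tcat (@col L P M d n') (d n')
  end.
Arguments col {L P M} d n.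

Lemma eq_col L (P : nat -> fctx L) (M : structure L)
    (d d' : forall i, tup (P i) M) n :
  (forall i, i < n -> d i = d' i) -> col d n = col d' n.
Proof.
elim: n => //= n IH H; rewrite IH ?H // => i ni; apply: H; exact: ltnW.
Qed.

Lemma tmap_col L (C N : structure L) (h : forall s, C s -> N s)
    (P : nat -> fctx L) (d : forall i, tup (P i) C) n :
  tmap h (col d n) = col (fun i => tmap h (d i)) n.
Proof.
elim: n => [|n IH] /=; first by apply: functional_extensionality_dep => -[].
by rewrite tmap_cat IH.
Qed.

Lemma natural_cell L (P : nat -> fctx L) (Z : ctx L) i j
    (F : forall M, tup Z M -> tup (cells P) M) :
  natural F -> natural (fun M a => cell (F M a) i j).
Proof. by move=> nF x; have [z [e H]] := nF (existT _ i (j, x)); exists z, e. Qed.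

Lemma natural_col L (P : nat -> fctx L) (Z : ctx L) n (c : nat -> nat)
    (F : forall M, tup Z M -> tup (cells P) M) :
  natural F -> natural (fun M a => col (fun i => cell (F M a) i (c i)) n).
Proof.
move=> nF; elim: n => [|n IH] /=; first by case.
by refine (natural_cat IH _); apply: natural_cell.
Qed.

Lemma natural_recol L (P : nat -> fctx L) (t : nat -> nat -> nat) :
  natural (fun M => @recol L P t M).
Proof. by move=> [i [j x]]; exists (existT _ i (t i j, x)), erefl. Qed.

Definition cell_rank L (P : nat -> fctx L) (v : cells P) : nat :=
  pickle (v : {i : nat & (nat * 'I_(flen (P i)))%type}).

Lemma cell_rank_inj L (P : nat -> fctx L) : injective (@cell_rank L P).
Proof. exact: pcan_inj pickleK. Qed.

(** [e] is the limit of [y] along increasing choices of columns, so it inherits what all such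
    choices satisfy. The second clause is mutual indiscernibility over [z], since each row may be
    reindexed independently. *)
Lemma indiscernible_array L (kappa : Type) (C : structure L) (Z : ctx L)
    (P : nat -> fctx L) (n : nat) (z : tup Z C) (y : tup (cells P) C) :
  saturated kappa C -> [set: nat] #<= [set: kappa] ->
  card_lt (range_of z) [set: kappa] ->
  exists e : tup (cells P) C,
    (forall m (D : forall M : structure L, tup (csum Z (cells P)) M -> Prop),
      definable D ->
      (forall s, (forall i, i < n -> incr_upto m (s i)) ->
         D C (tcat z (recol s y))) -> D C (tcat z e)) /\
    forall t, (forall i, incr (t i)) -> teq z (recol t e) e.
Proof.
move=> satC kinf zs.
have [U [UU oU]] := @ultraFilterLemma nat \oo _.
have U_free b : U [set j | b < j] by apply: oU; exists b.+1.
(* Rows from [n] on become constant, so that reindexing does not affect them. *)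
pose mask (s : nat -> nat -> nat) i := if i < n then s i else fun=> 0.
have FF := iter_limit_filter UU n.
have [e He] := filter_limit (fun s => recol (mask s) y) satC kinf zs
  (@cell_rank_inj L P) FF (fun phi => id).
exists e; split=> [m D dD Hs|t ti phi].
  apply: He dD _; apply: filterS (iter_limit_incr UU U_free n m) => s si /=.
  by apply: Hs => i i_n; rewrite /mask i_n; exact: si.
have dphi : definable (fun M a => sat phi a :> Prop) by exists phi.
(* Invariance under [t] is itself a definable condition, so it passes to the limit. *)
have dD : definable (fun M (a : tup (csum Z (cells P)) M) =>
    sat phi (tcat (tfst a) (recol t (tsnd a))) <-> sat phi (tcat (tfst a) (tsnd a))).
  apply: def_iff; apply: def_sat; last by prove_natural.
  prove_natural; apply: (natural_comp (F := fun M => @recol L P t M) (natural_recol t)).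
  by prove_natural.
apply: (He _ dD).
have [V [g [phi' [_ H]]]] := fin_par phi.
pose m := (\max_(i : V) (projT2 (g i : cells P)).1).+1.
have gm i : (projT2 (g i : cells P)).1 < m.
  by rewrite ltnS (leq_bigmax (F := fun i : V => (projT2 (g i : cells P)).1)).
pose Q s := sat phi (tcat z (recol (mask s) y)).
have dQ : depends_on_rows n m Q.
  move=> s s' ss'; rewrite /Q !H; suff -> : pull g (recol (mask s) y) =
    pull g (recol (mask s') y) by [].
  apply: functional_extensionality_dep => i; rewrite /pull /recol /mask.
  by case: ifP => // i_n; rewrite ss'.
apply: filterS (iter_limit_shift UU ti dQ) => s /=; rewrite /Q.
suff -> : recol (mask (fun i => s i \o t i)) y = recol t (recol (mask s) y).
  by move=> E; split=> /E.
by apply: functional_extensionality_dep => -[i [j x]]; rewrite /recol /mask /=; case: ifP.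
Qed.

(** * The inductive step along a strictly nonforking sequence *)

Lemma teq_natural L (M : structure L) (Z X W : ctx L) (z : tup Z M)
    (a a' : tup X M) (F : forall M, tup (csum Z X) M -> tup W M) :
  natural F -> teq z a a' -> teq z (F M (tcat z a)) (F M (tcat z a')).
Proof.
move=> nF H phi.
have dD : definable (fun M (b : tup (csum Z X) M) =>
    sat phi (tcat (tfst b) (F M b))) by apply: def_sat; prove_natural.
exact: (def_teq H dD).
Qed.

Lemma teq_elementary L (C N : structure L) (h : forall s, C s -> N s)
    (Z X : ctx L) (z : tup Z C) (a a' : tup X C) :
  elementary h -> teq z a a' -> teq (tmap h z) (tmap h a) (tmap h a').
Proof. by move=> hE H phi; rewrite -!tmap_cat -!hE. Qed.

Lemma range_of_col L (P : nat -> fctx L) (M : structure L)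
    (d : forall i, tup (P i) M) n e :
  range_of (col d n) e -> exists2 i, i < n & range_of (d i) e.
Proof.
elim: n => [[[]//]|n IH] /=; rewrite range_of_cat => -[/IH[i i_n di]|dn].
  by exists i => //; exact: ltnW.
by exists n.
Qed.

Section Realization.
Variables (L : language) (kappa' : Type) (C N : structure L).
Variables (h : forall s, C s -> N s) (A : set (elt C)).
Hypotheses (hE : elementary h) (satN : saturated kappa' N).
Hypothesis smallC : card_lt [set: elt C] [set: kappa'].
Let tA := @tset L C A.
Let hA := tmap h tA.

Lemma emap_image : emap h @` A `<=` range_of hA.
Proof. by rewrite range_of_tmap range_of_tset. Qed.

Lemma range_of_tmap_sub (X : ctx L) (u : tup X C) :
  range_of (tmap h u) `<=` range (emap h).
Proof. by rewrite range_of_tmap; apply: image_subset. Qed.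

(* If [d = g(A, a)], then [ds = g(A, x)] for a realization [x] of a strictly
   nondividing global extension of [tp(a/B)]: the last two clauses say that
   neither [tp(ds/C)] nor [tp(C/A ds)] divides over [A] *)
Lemma strictly_free_witness (X Q : fctx L) (V : ctx L) (a : tup X C)
    (d : tup Q C) (r : tup V C) (B : set (elt C)) :
  strictly_free h A (tp a B) -> A `<=` B -> range_of r `<=` B ->
  range_of d `<=` A `|` range_of a ->
  exists ds : tup Q N,
  [/\ forall th : formula (csum (cset A) (csum V Q)),
        sat th (tcat tA (tcat r d)) -> sat th (tcat hA (tcat (tmap h r) ds)),
      forall (W : ctx L) (w : formula (csum Q (csum (cset A) W)))
          (u : tup W C) (u_ : nat -> tup W C),
        sat w (tcat ds (tcat hA (tmap h u))) -> (forall j, teq tA (u_ j) u) ->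
        forall K, exists J : seq nat, [/\ uniq J, size J = K &
          exists y : tup Q N, forall j, j \in J ->
            sat w (tcat y (tcat hA (tmap h (u_ j))))]
    & forall (W : ctx L) (w : formula (csum W (csum (cset A) Q)))
          (u : tup W C) (c : nat -> tup Q C),
        sat w (tcat (tmap h u) (tcat hA ds)) -> (forall j, teq tA (c j) d) ->
        forall K, exists J : seq nat, [/\ uniq J, size J = K &
          exists y : tup W N, forall j, j \in J ->
            sat w (tcat y (tcat hA (tmap h (c j))))]].
Proof.
move=> free AB rB; rewrite -[A in range_of d `<=` A `|` _]range_of_tset -range_of_cat.
move=> /range_pull[g dE].
have [x [Hx nd1 nd2]] := strictly_free_realized satN smallC free.
exists (pull g (tcat hA x)).
have ext (th : formula (csum (cset A) (csum V Q))) :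
    sat th (tcat tA (tcat r d)) ->
    sat th (tcat hA (tcat (tmap h r) (pull g (tcat hA x)))).
  have [w Hw] : definable (fun M (b : tup (csum X (csum (cset A) V)) M) =>
      sat th (tcat (tfst (tsnd b)) (tcat (tsnd (tsnd b))
        (pull g (tcat (tfst (tsnd b)) (tfst b)))))).
    by apply: def_sat; prove_natural.
  have [V' [g' [w' [_ H]]]] := fin_par w.
  move=> Sth; have : psat (pmap_par h (PFml w' (pull g' (tcat tA r)) : pfml C X)) x.
    apply: Hx; split.
      apply: subset_trans (@range_of_pull _ _ _ _ g' _) _.
      by rewrite range_of_cat range_of_tset => e [/AB|/rB].
    by rewrite /psat /= -H Hw /= -dE.
  by rewrite /psat /= tmap_pull tmap_cat -H Hw.
(* One direction is enough, applied to a formula and to its negation. *)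
have dteq : teq hA (tmap h d) (pull g (tcat hA x)).
  have dir (th : formula (csum (cset A) Q)) :
      sat th (tcat hA (tmap h d)) -> sat th (tcat hA (pull g (tcat hA x))).
    have [w Hw] : definable (fun M (b : tup (csum (cset A) (csum V Q)) M) =>
      sat th (tcat (tfst b) (tsnd (tsnd b)))) by apply: def_sat; prove_natural.
    rewrite -tmap_cat -hE => Sth; apply/(Hw _ (tcat hA (tcat (tmap h r) _))).
    by apply: ext; apply/Hw.
  move=> th; split; first exact: dir.
  by move=> S; apply: contrapT => nS; exact: (dir (Neg th)).
split=> // [W' w u u_|W' w u c] Sw teqs K.
- have [w' Hw'] : definable (fun M (b : tup (csum X (csum (cset A) W')) M) =>
      sat w (tcat (pull g (tcat (tfst (tsnd b)) (tfst b)))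
        (tcat (tfst (tsnd b)) (tsnd (tsnd b))))) by apply: def_sat; prove_natural.
  have [|||j|J [uJ sJ [y Hy]]] := nondividing_par (z := hA) (w := w')
    (u := tmap h (tcat tA u)) (u_ := fun j => tmap h (tcat tA (u_ j))) nd1 _ _ _ _ K.
  + exact: emap_image.
  + exact: range_of_tmap_sub.
  + by rewrite Hw' tmap_cat.
  + apply: teq_elementary => //.
    exact: (teq_natural (F := fun M b => b) (@natural_id _ _)).
  exists J; split=> //; exists (pull g (tcat hA y)) => j /Hy.
  by rewrite Hw' tmap_cat.
have [k kE] : exists k, tmap h u = pull k (@tset L N (range (emap h))).
  by apply: range_pull; rewrite range_of_tset; exact: range_of_tmap_sub.
have [w' Hw'] : definable (fun M
    (b : tup (csum (cset (range (emap h))) (csum (cset A) Q)) M) =>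
      sat w (tcat (pull k (tfst b)) (tsnd b))) by apply: def_sat; prove_natural.
have [|||j|J [uJ sJ [y Hy]]] := nondividing_par (z := hA) (w := w')
    (u := tcat hA (pull g (tcat hA x))) (u_ := fun j => tcat hA (tmap h (c j))) nd2 _ _ _ _ K.
+ exact: emap_image.
+ rewrite range_of_cat subUset; split.
    by rewrite range_of_tmap range_of_tset; exact: subsetUl.
  apply: subset_trans (@range_of_pull _ _ _ _ g _) _.
  by rewrite range_of_cat range_of_tmap range_of_tset.
+ by rewrite Hw' /= -kE.
+ apply: (teq_natural (F := fun M b => b) (@natural_id _ _)) => phi.
  by rewrite -dteq; apply: teq_elementary.
by exists J; split=> //; exists (pull k y) => j /Hy; rewrite Hw'.
Qed.

End Realization.

Lemma automorphism_elementary L (M : structure L) (g : forall s, M s -> M s) :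
  automorphism g -> elementary g.
Proof.
move=> [gB gF gR]; have gT (X : ctx L) (a : tup X M) s (t : term X s) :
    g _ (teval a t) = teval (tmap g a) t.
  elim: t => //= f u IH; rewrite gF; congr finterp.
  exact: functional_extensionality_dep.
move=> X phi; elim: phi => {X} [X|X s t u|X r t|X phi IH1 psi IH2|X s phi IH] a //=.
- by rewrite -!gT; split=> [->//|]; apply: (bij_inj (gB _)).
- rewrite gR; suff -> : (fun i => g _ (teval a (t i))) =
    (fun i => teval (tmap g a) (t i)) by [].
  by apply: functional_extensionality_dep => i; rewrite gT.
- by rewrite IH1 IH2.
have gtext m : tmap g (text a m) = text (tmap g a) (g _ m).
  by apply: functional_extensionality_dep => -[].
split=> H m; last by rewrite IH gtext.
by have [g' _ gK] := gB s; rewrite -(gK m) -gtext -IH.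
Qed.

(** A word stands for a branch through [n] rows with columns below [K], or for a list of columns;
    conditions on all of them form a finite conjunction. *)
Lemma def_all_words L (Z : ctx L) n K
    (D : seq nat -> forall M : structure L, tup Z M -> Prop) :
  (forall s, definable (D s)) ->
  definable (fun M a => forall s, size s = n -> all (gtn K) s -> D s M a).
Proof.
elim: n D => [|n IH] D dD.
  apply: def_ext (dD [::]) => M a; split=> [H s /size0nil->//|]; exact.
have := def_all_lt K (fun j => IH (fun s => D (j :: s)) (fun s => dD _)).
apply: def_ext => M a; split=> [H [//|j s] /= [sn] /andP[jK sK]|H j jK s sn sK].
  exact: H.
by apply: H; rewrite /= ?sn ?jK ?sK.
Qed.

Lemma incr_enumeration (J : seq nat) : uniq J ->
  exists t, incr t /\ forall m, m < size J -> t m \in J.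
Proof.
move=> uJ; pose B := (\max_(j <- J) j).+1.
pose s := sort leq J.
have ss : sorted ltn s.
  by rewrite ltn_sorted_uniq_leq sort_uniq uJ (sort_sorted leq_total).
have sJ j : (j \in s) = (j \in J) by rewrite mem_sort.
have sz : size s = size J by rewrite size_sort.
have sB j : j \in J -> j < B by move=> jJ; rewrite ltnS (leq_bigmax_seq (F := id)).
(* Past the end of the list, the values continue above the bound [B] to keep the sequence
   increasing. *)
exists (fun m => if m < size J then nth 0 s m else B + m); split=> [i j ij|m mJ].
  case: ifP => iJ; case: ifP => jJ.
  - apply: (sorted_ltn_nth ltn_trans) => //; by rewrite inE sz.
  - by apply: leq_trans (leq_addr _ _); apply: sB; rewrite -sJ mem_nth ?sz.
  - by rewrite (ltn_trans ij jJ) in iJ.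
  - by rewrite ltn_add2l.
by rewrite mJ -sJ mem_nth ?sz.
Qed.

(* [Q] fails on one of [k] consecutive blocks of length [m] below [k * m] and
   on another one above; the required positions are taken in these blocks. *)
Lemma incr_avoiding (Q : nat -> Prop) k m r :
  (forall J, uniq J -> size J = k -> ~ forall j, j \in J -> Q j) -> r < m ->
  exists t, [/\ incr t, t r = k * m & forall j, j < m -> j <> r -> ~ Q (t j)].
Proof.
move=> HQ rm.
(* Otherwise one index from each of the [k] blocks gives [k] distinct indices at which [Q] holds. *)
have block o : exists2 b, b < k & forall j, j < m -> ~ Q (o + b * m + j).
  apply: contrapT => nb.
  have Hb b : exists j, b < k -> j < m /\ Q (o + b * m + j).
    have [bk|] := boolP (b < k); last by exists 0.
    apply: contrapT => nj; apply: nb; exists b => // j jm Qj.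
    by apply: nj; exists j.
  have [f Hf] := choice Hb.
  apply: (HQ [seq o + b * m + f b | b <- iota 0 k]).
  - rewrite map_inj_in_uniq ?iota_uniq // => b b'; rewrite !mem_iota /= => bk b'k.
    have [fm _] := Hf b bk; have [fm' _] := Hf b' b'k.
    rewrite -!addnA => /addnI E.
    have := congr1 (fun x => x %/ m) E.
    by rewrite !divnMDl ?divn_small ?addn0 //; apply: leq_ltn_trans rm.
  - by rewrite size_map size_iota.
  - by move=> j /mapP[b + ->]; rewrite mem_iota /= => bk; have [] := Hf b bk.
have [b bk Hb] := block 0; have [b' _ Hb'] := block (k * m).+1.
exists (fun j => if j < r then b * m + j else if j == r then k * m
  else (k * m).+1 + b' * m + j); split.
- have bm j : j < m -> b * m + j < k * m.
    move=> jm; apply: (@leq_trans (b.+1 * m)); first by rewrite mulSn addnC ltn_add2r.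
    by rewrite leq_mul2r bk orbT.
  move=> i j ij; case: ifP => ir.
    case: ifP => jr; first by rewrite ltn_add2l.
    have im : i < m := ltn_trans ir rm.
    case: ifP => _; first exact: bm.
    apply: leq_trans (bm i im) _; apply: leq_trans (leqnSn _) _.
    by rewrite -addnA leq_addr.
  case: (ltngtP j r) ir => [jr|rj|jr]; first by rewrite (ltn_trans ij jr).
    move=> ir; case: eqP => _; last by rewrite ltn_add2l.
    by rewrite -addnA ltnS leq_addr.
  by rewrite -jr ij.
- by rewrite ltnn eqxx.
move=> j jm /eqP jr; rewrite (negbTE jr); case: ifP => _; first exact: Hb.
exact: Hb'.
Qed.

Definition upd (c : nat -> nat) (i v : nat) : nat -> nat :=
  fun i' => if i' == i then v else c i'.

Lemma finite_bound (T : Type) (F : set T) (Q : T -> nat -> Prop) :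
  finite_set F -> (forall x, F x -> exists m, Q x m) ->
  exists m0, forall x, F x -> exists2 m, m < m0 & Q x m.
Proof.
move: F; apply: finite_ind => [|F x IH] H; first by exists 0.
have [m0 H0] := IH (fun y Fy => H y (or_introl Fy)).
have [m Qm] := H x (or_intror erefl).
exists (maxn m0 m.+1) => y [/H0[m' lt Q']|->].
  by exists m' => //; rewrite leq_max lt.
by exists m => //; rewrite leq_max leqnn orbT.
Qed.

Definition cells_of L (P : nat -> fctx L) (M : structure L)
    (y : forall i, nat -> tup (P i) M) : tup (cells P) M :=
  fun v => y (projT1 v) (projT2 v).1 (projT2 v).2.

Section Array.
Variables (L : language) (T : set (sentence L)) (kappa : Type).
Variables (C N : structure L) (h : forall s, C s -> N s) (A : set (elt C)).
Hypotheses (T_dep : dependent T) (NT : models N T).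
Hypotheses (satC : saturated kappa C) (homC : strongly_homogeneous kappa C).
Hypotheses (hE : elementary h) (kinf : [set: nat] #<= [set: kappa]).
Hypothesis smallA : card_lt A [set: kappa].
Let tA := @tset L C A.
Let hA := tmap h tA.

Variables (Y : fctx L) (P : nat -> fctx L).
Variables (phi : forall i, formula (csum Y (P i))).
Variables (d : forall i, tup (P i) C) (k : nat -> nat).
Arguments d : clear implicits.

Definition row_inconsistent (M : structure L) (y : tup (cells P) M) i :=
  forall J : seq nat, uniq J -> size J = k i ->
    ~ exists x : tup Y M, forall j, j \in J -> sat (phi i) (tcat x (cell y i j)).

Lemma def_row_inc i (J : seq nat) :
  definable (fun M (y : tup (cells P) M) =>
    ~ exists x : tup Y M, forall j, j \in J -> sat (phi i) (tcat x (cell y i j))).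
Proof.
apply: def_not; apply: (def_ex (D := fun M b =>
  forall j, j \in J -> sat (phi i) (tcat (tsnd b) (cell (tfst b) i j)))).
apply: def_all_seq => j; apply: def_sat; prove_natural.
by apply: natural_cell; prove_natural.
Qed.

Definition branch (M : structure L) (y : tup (cells P) M) (c : nat -> nat) n :
  tup (rows P n) M := col (fun i => cell y i (c i)) n.
Arguments branch {M} y c n.

Lemma natural_branch (Z : ctx L) (F : forall M, tup Z M -> tup (cells P) M) c n :
  natural F -> natural (fun M a => branch (F M a) c n).
Proof. exact: natural_col. Qed.

(** * All branches have the same type over the new entry *)

Section Constancy.
Variables (n : nat) (e : tup (cells P) C) (ds : tup (P n) N).
Hypothesis e_ind : forall t, (forall i, incr (t i)) -> teq tA (recol t e) e.
Hypothesis ds_nd : forall (W : ctx L) (w : formula (csum (P n) (csum (cset A) W)))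
    (u : tup W C) (u_ : nat -> tup W C),
  sat w (tcat ds (tcat hA (tmap h u))) -> (forall j, teq tA (u_ j) u) ->
  forall K, exists J : seq nat, [/\ uniq J, size J = K &
    exists y : tup (P n) N, forall j, j \in J ->
      sat w (tcat y (tcat hA (tmap h (u_ j))))].
Variable th : formula (csum (cset A) (csum (rows P n) (P n))).

Let th_at c := sat th (tcat hA (tcat (tmap h (branch e c n)) ds)).

(* Otherwise the pairs [(s (l(v+1)), s (l(v+1)+v))] witness, by nondividing,
   an alternation of [th] along the indiscernible sequence [s], i.e. IP. *)
Lemma constant_on_row c i v : th_at (upd c i 0) -> th_at (upd c i v).
Proof.
move=> th0; apply: contrapT => nthv.
have v0 : v <> 0 by move=> v0; rewrite v0 in nthv.
(* The branches that differ from [c] at most in row [i]: in [e] they form an indiscernible sequence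
   over [A]. *)
pose s (M : structure L) (y : tup (cells P) M) m := branch y (upd c i m) n.
have sT (M : structure L) (y : tup (cells P) M) t m :
    s M (recol (fun i' j => if i' == i then t j else j) y) m = s M y (t m).
  by apply: eq_col => i' _; rewrite /cell /recol /upd /=; case: (i' == i).
have [w Hw] : definable (fun M (b : tup (csum (P n) (csum (cset A)
    (csum (rows P n) (rows P n)))) M) =>
    sat th (tcat (tfst (tsnd b)) (tcat (tfst (tsnd (tsnd b))) (tfst b))) /\
    ~ sat th (tcat (tfst (tsnd b)) (tcat (tsnd (tsnd (tsnd b))) (tfst b)))).
  by apply: def_and; [|apply: def_not]; apply: def_sat; prove_natural.
pose u_ l := tcat (s C e (l * v.+1)) (s C e (l * v.+1 + v)).
have u_teq l : teq tA (u_ l) (tcat (s C e 0) (s C e v)).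
  (* Translating row [i] carries the initial pair to the pair of number [l]. *)
  pose t j := j + l * v.+1.
  have ti i' : incr (fun j => if i' == i then t j else j).
    by move=> j j' jj'; case: ifP => // _; rewrite /t ltn_add2r.
  have nF : natural (fun M (b : tup (csum (cset A) (cells P)) M) =>
      tcat (s M (tsnd b) 0) (s M (tsnd b) v)).
    by prove_natural; apply: natural_branch; prove_natural.
  by have := teq_natural nF (e_ind ti); rewrite /= !sT /t add0n addnC.
have ND K : exists J : seq nat, [/\ uniq J, size J = K &
    exists y : tup (P n) N, forall j, j \in J ->
      sat th (tcat hA (tcat (tmap h (s C e (j * v.+1))) y)) /\
      ~ sat th (tcat hA (tcat (tmap h (s C e (j * v.+1 + v))) y))].
  have [|//|J [uJ sJ [y Hy]]] := ds_nd (w := w)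
      (u := tcat (s C e 0) (s C e v)) (u_ := u_) _ _ K.
    by apply/Hw; rewrite tmap_cat; split.
  by exists J; split=> //; exists y => j /Hy/Hw; rewrite tmap_cat.
pose w0 (M : structure L) (b : tup (csum (P n) (csum (cset A) (rows P n))) M) :=
  sat th (tcat (tfst (tsnd b)) (tcat (tsnd (tsnd b)) (tfst b))).
have [f0 Hf0] : definable w0 by apply: def_sat; prove_natural.
have [V [g [w' [_ Hw']]]] := fin_par f0.
apply: T_dep; exists N; split=> //; exists (P n), V, w'.
exists (fun m => pull g (tcat hA (tmap h (s C e m)))) => S F fF FS.
pose Q psi m := (S m /\ psi = PFml w' (pull g (tcat hA (tmap h (s C e m))))) \/
  (~ S m /\ psi = PFml (Neg w') (pull g (tcat hA (tmap h (s C e m))))).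
have [|m0 Hm0] := @finite_bound _ F Q fF.
  by move=> psi /FS[[m Sm <-]|[m Sm <-]]; exists m; [left|right].
suff [p Hp] : exists p : tup (P n) N, forall m, m < m0 ->
    S m <-> sat th (tcat hA (tcat (tmap h (s C e m)) p)).
  exists p => psi /Hm0[m /Hp[H1 H2] [[Sm ->]|[Sm ->]]]; rewrite /psat /= -Hw' Hf0.
    exact: H1.
  by move/H2.
have [J [uJ sJ [y Hy]]] := ND m0.
have [jt [jti jtJ]] := incr_enumeration uJ.
(* The left or the right member of a pair is taken according to [S m]; the pairs occupy disjoint
   blocks of length [v.+1], so [t] is increasing. *)
pose t m := if `[< S m >] then jt m * v.+1 else jt m * v.+1 + v.
have ti : incr t.
  move=> m m' mm'; apply: (@leq_trans ((jt m).+1 * v.+1)).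
    rewrite /t mulSn [v.+1 + _]addnC; case: ifP => _; last by rewrite ltn_add2l.
    by rewrite -[ltnLHS]addn0 ltn_add2l.
  apply: (@leq_trans (jt m' * v.+1)); first by rewrite leq_mul2r jti.
  by rewrite /t; case: ifP => // _; exact: leq_addr.
have ti' i' : incr (fun j => if i' == i then t j else j).
  by move=> j j' jj'; case: ifP => // _; exact: ti.
(* Existence of [p] is a formula about the array: it holds after reindexing by [t] because of [y],
   hence before it by indiscernibility. *)
have dD : definable (fun M (b : tup (csum (cset A) (cells P)) M) =>
    exists p : tup (P n) M, forall m, m < m0 ->
      (S m <-> sat th (tcat (tfst b) (tcat (s M (tsnd b) m) p)))).
  apply: (def_ex (D := fun M b => forall m, m < m0 ->
      (S m <-> sat th (tcat (tfst (tfst b)) (tcat (s M (tsnd (tfst b)) m) (tsnd b)))))).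
  apply: def_all_lt => m; apply: def_iff; first exact: def_const.
  apply: def_sat; prove_natural; apply: natural_branch; prove_natural.
have sh m : tmap h (s C e m) = s N (tmap h e) m by rewrite /s /branch tmap_col.
have E1 := def_elementary (tcat tA e) hE dD.
have E2 := def_elementary (tcat tA (recol (fun i' j => if i' == i then t j else j) e)) hE dD.
have E3 := def_teq (e_ind ti') dD.
have [|p Hp] := E1.1 (E3.1 (E2.2 _)).
  exists y => m mm0; rewrite tmap_cat (tmap_natural h _ (natural_recol _)).
  have -> (u : tup (cells P) N) : tsnd (tcat (tmap h tA) u) = u by [].
  have [H1 H2] := Hy _ (jtJ m (leq_trans mm0 (eq_leq (esym sJ)))).
  rewrite sT -sh /t; case: asboolP => Sm; first by split.
  by split=> // H; case: H2.
by exists p => m /Hp; rewrite tmap_cat sh.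
Qed.

(** The rows are moved one at a time from column [0] to column [c i]. *)
Lemma constant_on_branches c :
  sat th (tcat hA (tcat (tmap h (branch e (fun=> 0) n)) ds)) ->
  sat th (tcat hA (tcat (tmap h (branch e c n)) ds)).
Proof.
move=> H0; pose c_ m i := if i < m then c i else 0.
have Hc m : th_at (c_ m).
  elim: m => [|m]; first exact: H0.
  have -> : c_ m = upd (c_ m) m 0.
    by apply/funext => i; rewrite /upd /c_; case: eqP => // ->; rewrite ltnn.
  have -> : c_ m.+1 = upd (c_ m) m (c m).
    apply/funext => i; rewrite /upd /c_ ltnS leq_eqVlt.
    by case: eqP => //= ->.
  exact: constant_on_row.
have := Hc n; rewrite /th_at; suff -> : branch e (c_ n) n = branch e c n by [].
by apply: eq_col => i i_n; rewrite /c_ i_n.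
Qed.
End Constancy.

(** * Finite approximations in [N] and their limits in [C] *)

Definition inc_upto (M : structure L) (y : tup (cells P) M) n K :=
  forall i, i < n -> forall J : seq nat, size J = k i -> all (gtn K) J -> uniq J ->
    ~ exists x : tup Y M, forall j, j \in J -> sat (phi i) (tcat x (cell y i j)).

(** Restricting to one formula [th] and to columns below [K] makes the condition on the array
    first-order, as the use of nondividing in the induction step requires. *)
Definition approx n := forall th : formula (csum (cset A) (rows P n)),
  sat th (tcat tA (col d n)) -> forall K, exists y : tup (cells P) N,
    (forall c, (forall i, i < n -> c i < K) -> sat th (tcat hA (branch y c n))) /\
    inc_upto y n K.

Definition follows_type (y : tup (cells P) C) n :=
  forall th : formula (csum (cset A) (rows P n)),
  sat th (tcat tA (col d n)) -> forall c, sat th (tcat tA (branch y c n)).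

Lemma approx_limit n : approx n -> exists y : tup (cells P) C,
  follows_type y n /\ forall i, i < n -> row_inconsistent y i.
Proof.
move=> Sn.
have /choice[y_ Hy] : forall l : formula (csum (cset A) (rows P n)) * nat,
    exists y : tup (cells P) N, sat l.1 (tcat tA (col d n)) ->
    (forall c, (forall i, i < n -> c i < l.2) -> sat l.1 (tcat hA (branch y c n))) /\
    inc_upto y n l.2.
  move=> [th K]; have [/Sn/(_ K)[y Hy]|nth] := pselect (sat th (tcat tA (col d n))).
    by exists y.
  (* For a formula outside the type any array serves; here all cells of a row are copies of the same
     [d i]. *)
  by exists (fun v => h (d _ (projT2 v).2)).
(* Pairs are ordered by implication over [A] and by the bound; conjunction and maximum make this a
   filter of tails. *)
pose F : set_system (formula (csum (cset A) (rows P n)) * nat) :=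
  [set Q | exists th K, sat th (tcat tA (col d n)) /\
    forall l, sat l.1 (tcat tA (col d n)) ->
    (forall u : tup (rows P n) N, sat l.1 (tcat hA u) -> sat th (tcat hA u)) ->
    K <= l.2 -> Q l].
have FF : ProperFilter F.
  split=> [[th [K [Sth /(_ (th, K) Sth)]]]|]; first exact.
  split=> [|Q Q' [th [K [Sth H]]] [th' [K' [Sth' H']]]|Q Q' sQ [th [K [Sth H]]]].
  - by exists (Neg Fls), 0; split=> //; exact: id.
  - have [w Hw] := def_and (def_sat th (@natural_id _ _)) (def_sat th' (@natural_id _ _)).
    exists w, (maxn K K'); split; first exact/Hw.
    move=> l Sl lw; rewrite geq_max => /andP[KK KK'].
    by split; [apply: H|apply: H'] => // u /lw/Hw[].
  - by exists th, K; split=> // l ? ? ?; apply/sQ/H.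
have [|y Dy] := filter_limit y_ satC kinf (z := tA) (z' := hA) _
    (@cell_rank_inj L P) FF (fun w => (hE w tA).2).
  by rewrite range_of_tset.
exists y; split=> [th Sth c|i i_n J uJ sJ].
  have dD : definable (fun M (b : tup (csum (cset A) (cells P)) M) =>
      sat th (tcat (tfst b) (branch (tsnd b) c n))).
    by apply: def_sat; prove_natural; apply: natural_branch; prove_natural.
  apply: (Dy _ dD); exists th, (\max_(i < n) c i).+1; split=> // l Sl lth Kl /=.
  apply: lth; apply: (Hy l Sl).1 => i i_n; apply: leq_trans Kl.
  by rewrite ltnS (leq_bigmax (F := fun i : 'I_n => c i) (Ordinal i_n)).
have dD : definable (fun M (b : tup (csum (cset A) (cells P)) M) =>
    ~ exists x : tup Y M, forall j, j \in J -> sat (phi i) (tcat x (cell (tsnd b) i j))).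
  by apply: (def_comp (F := fun M b => tsnd b) (def_row_inc i J)); prove_natural.
apply: (Dy _ dD); exists (Neg Fls), (\max_(j <- J) j).+1; split=> [|l Sl _ Kl].
  exact: id.
apply: (Hy l Sl).2 => //; apply/allP => j jJ /=; apply: leq_trans Kl.
by rewrite ltnS (leq_bigmax_seq (F := id)).
Qed.

Lemma finite_rows n : finite_set [set: rows P n].
Proof.
elim: n => [|n IH] /=; first exact: finite_finset.
rewrite (_ : [set: _] = (@inl (rows P n) (P n) @` setT) `|` (inr @` setT)).
  by rewrite finite_setU; split; apply: finite_image => //; exact: finite_finset.
by apply/seteqP; split=> // -[x|x] _; [left|right]; exists x.
Qed.

Lemma small_ctx n : card_lt [set: csum (cset A) (rows P n)] [set: kappa].
Proof.
rewrite (_ : [set: _] = (@inl (cset A) (rows P n) @` setT) `|` (inr @` setT)); last first.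
  by apply/seteqP; split=> // -[x|x] _; [left|right]; exists x.
apply: card_lt_setU => //; last by apply: finite_image; exact: finite_rows.
apply: card_lt_le smallA; apply: card_le_trans (card_image_le _ _) _.
apply: (@fun_card_le _ _ _ _ (fun e : cset A => sval e)) =>
  [[e Ae]//|[e Ae] [e' Ae'] _ _ /= E].
by subst e'; rewrite (Prop_irrelevance Ae Ae').
Qed.

(** Once the array is indiscernible, its branch through column [0] has the type of [col d n] over
    [A]. Homogeneity moves it there by an automorphism fixing [A], since [A] is part of the tuple
    being moved. *)
Lemma approx_array n : approx n -> exists e : tup (cells P) C,
  [/\ follows_type e n, forall i, i < n -> row_inconsistent e i,
      forall t, (forall i, incr (t i)) -> teq tA (recol t e) e
    & branch e (fun=> 0) n = col d n].
Proof.
move=> /approx_limit[y [y_type y_inc]].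
have [|e [eD e_ind]] := indiscernible_array n (z := tA) y satC kinf.
  by rewrite range_of_tset.
have e_type : follows_type e n.
  move=> th Sth c.
  have dD : definable (fun M (b : tup (csum (cset A) (cells P)) M) =>
      sat th (tcat (tfst b) (branch (tsnd b) c n))).
    by apply: def_sat; prove_natural; apply: natural_branch; prove_natural.
  by apply: (eD 0 _ dD) => s _; exact: (y_type th Sth (fun i => s i (c i))).
have e_inc i : i < n -> row_inconsistent e i.
  move=> i_n J uJ sJ.
  have dD : definable (fun M (b : tup (csum (cset A) (cells P)) M) =>
      ~ exists x : tup Y M, forall j, j \in J -> sat (phi i) (tcat x (cell (tsnd b) i j))).
    by apply: (def_comp (F := fun M b => tsnd b) (def_row_inc i J)); prove_natural.
  (* Below [m] the choice [s i] is injective, so the image of [J] keeps its size. *)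
  pose m := (\max_(j <- J) j).+1.
  apply: (eD m _ dD) => s si [x Hx]; apply: (y_inc i i_n (map (s i) J)).
  - rewrite map_inj_in_uniq // => j j' jJ j'J E.
    have jm j0 : j0 \in J -> j0 < m by move=> j0J; rewrite ltnS (leq_bigmax_seq (F := id)).
    by case: (ltngtP j j') => // lt; [have := si i i_n j j'|have := si i i_n j' j];
      rewrite lt jm // E ltnn => /(_ isT).
  - by rewrite size_map.
  - by exists x => j' /mapP[j jJ ->]; exact: Hx.
have t0 : teq tA (branch e (fun=> 0) n) (col d n).
  move=> th; split=> [S|Sth]; last exact: e_type.
  by apply: contrapT => nth; exact: (e_type (Neg th) nth (fun=> 0)).
have tp0 : tp (tcat tA (branch e (fun=> 0) n)) set0 = tp (tcat tA (col d n)) set0.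
  apply: (teq_tp (z := @tnil L C)) => // w.
  have nF : natural (fun M (b : tup (csum (cset A) (rows P n)) M) => tcat (@tnil L M) b).
    by prove_natural; case.
  have dD : definable (fun M (b : tup (csum (cset A) (rows P n)) M) =>
    sat w (tcat (@tnil L M) b)) by exact: def_sat.
  exact: (def_teq t0 dD).
have [g [g_aut gE]] := homC (small_ctx n) tp0.
have gelem := automorphism_elementary g_aut.
have gA : tmap g tA = tA.
  exact: (congr1 (fun b : tup (csum (cset A) (rows P n)) C => tfst b) gE).
have gd : branch (tmap g e) (fun=> 0) n = col d n.
  rewrite /branch -(tmap_col g (fun i => cell e i 0)).
  exact: (congr1 (fun b : tup (csum (cset A) (rows P n)) C => tsnd b) gE).
exists (tmap g e); split=> // [th Sth c|i i_n J uJ sJ|t ti].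
- rewrite /branch -(tmap_col g (fun i => cell e i (c i))) -gA -tmap_cat -gelem.
  exact: e_type.
- have [w Hw] := def_row_inc i J; apply/Hw; rewrite -gelem; apply/Hw.
  exact: e_inc.
rewrite -gA -(tmap_natural g _ (natural_recol t)).
by apply: teq_elementary => //; exact: e_ind.
Qed.

Variable c : forall i, nat -> tup (P i) C.
Arguments c : clear implicits.
Hypothesis c_teq : forall i j, teq tA (c i j) (d i).
Hypothesis c_inc : forall i, row_inconsistent (cells_of c) i.
Hypothesis witness : forall n, exists ds : tup (P n) N,
  [/\ forall th : formula (csum (cset A) (csum (rows P n) (P n))),
        sat th (tcat tA (tcat (col d n) (d n))) ->
        sat th (tcat hA (tcat (tmap h (col d n)) ds)),
      forall (W : ctx L) (w : formula (csum (P n) (csum (cset A) W)))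
          (u : tup W C) (u_ : nat -> tup W C),
        sat w (tcat ds (tcat hA (tmap h u))) -> (forall j, teq tA (u_ j) u) ->
        forall K, exists J : seq nat, [/\ uniq J, size J = K &
          exists y : tup (P n) N, forall j, j \in J ->
            sat w (tcat y (tcat hA (tmap h (u_ j))))]
    & forall (W : ctx L) (w : formula (csum W (csum (cset A) (P n))))
          (u : tup W C) (c : nat -> tup (P n) C),
        sat w (tcat (tmap h u) (tcat hA ds)) -> (forall j, teq tA (c j) (d n)) ->
        forall K, exists J : seq nat, [/\ uniq J, size J = K &
          exists y : tup W N, forall j, j \in J ->
            sat w (tcat y (tcat hA (tmap h (c j))))]].

Lemma approx0 : approx 0.
Proof.
move=> th Sth K; exists (tmap h (cells_of c)); split=> // c' _.
have := Sth; rewrite hE tmap_cat; congr (sat th (tcat _ _)).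
exact: tmap_col.
Qed.

(** One formula [w] describes the columns of [e] below [K] and their relation to [ds]; the terms of
    the dividing sequence that replace [ds] become row [n]. *)
Lemma approxS n : approx n -> approx n.+1.
Proof.
move=> /approx_array[e [_ e_inc e_ind e0]] th Sth K.
have [ds [ext nd1 nd2]] := witness n.
have th_branch c' : sat th (tcat hA (tcat (tmap h (branch e c' n)) ds)).
  by apply: constant_on_branches => //; rewrite e0; exact: ext.
have [w Hw] : definable (fun M (b : tup (csum (cells P) (csum (cset A) (P n))) M) =>
    (forall s, size s = n -> all (gtn K) s ->
       sat th (tcat (tfst (tsnd b)) (tcat (branch (tfst b) (nth 0 s) n) (tsnd (tsnd b))))) /\
    inc_upto (tfst b) n K).
  apply: def_and.
    apply: def_all_words => s; apply: def_sat; prove_natural.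
    by apply: natural_branch; prove_natural.
  apply: def_all_lt => i; apply: def_all_words => J; apply: def_imp; first exact: def_const.
  by apply: (def_comp (F := fun M b => tfst b) (def_row_inc i J)); prove_natural.
(* One term more than [K] keeps [J] nonempty even when [K] is [0]: the inconsistency of the old rows
   is read at the term [nth 0 J 0]. *)
have [||J [uJ sJ [y Hy]]] := nd2 _ w e (c n) _ _ K.+1.
- apply/Hw; split=> [s _ _|i i_n J sJ _ uJ].
    have := th_branch (nth 0 s); rewrite /branch tmap_col; exact.
  have [v Hv] := def_row_inc i J; apply/Hv; rewrite -hE; apply/Hv.
  exact: e_inc.
- exact: c_teq.
pose y' i j := if i < n then cell y i j else tmap h (c i (nth 0 J j)).
exists (cells_of y').
have yn i : i < n -> forall j, cell (cells_of y') i j = cell y i j.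
  move=> i_n j; apply: functional_extensionality_dep => x.
  by rewrite /cell /cells_of /y' /= i_n.
have ynn j : cell (cells_of y') n j = tmap h (c n (nth 0 J j)).
  by apply: functional_extensionality_dep => x; rewrite /cell /cells_of /y' /= ltnn.
split=> [c' cK|i].
  rewrite /branch /= ynn.
  rewrite (@eq_col _ _ _ _ (fun i => cell y i (nth 0 (mkseq c' n) i))); last first.
    by move=> i i_n; rewrite yn // nth_mkseq.
  have /Hy/Hw[+ _] : nth 0 J (c' n) \in J by rewrite mem_nth ?sJ ?ltnS ?(ltnW (cK _ _)).
  move=> /(_ (mkseq c' n)); rewrite size_mkseq; apply=> //.
  apply/allP => j /mapP[i]; rewrite mem_iota add0n /= => i_n ->.
  by apply: cK; exact: ltnW.
rewrite ltnS leq_eqVlt => /orP[/eqP ->|i_n] J' sJ' J'K uJ' [x Hx]; last first.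
  have /Hy/Hw[_ yinc] : nth 0 J 0 \in J by rewrite mem_nth ?sJ.
  apply: (yinc i i_n J' sJ' J'K uJ').
  by exists x => j /Hx; rewrite yn.
(* Distinct columns select distinct terms of [c n] because [J] has no repetition; the inconsistency
   is then transferred from [C] to [N]. *)
have cJ : ~ exists x : tup Y C, forall j, j \in map (nth 0 J) J' ->
    sat (phi n) (tcat x (cell (cells_of c) n j)).
  apply: c_inc; last by rewrite size_map.
  rewrite map_inj_in_uniq // => j j' /(allP J'K) /= jK /(allP J'K) /= j'K.
  by move/eqP; rewrite nth_uniq ?sJ ?ltnS ?(ltnW jK) ?(ltnW j'K) // => /eqP.
have [v Hv] := def_row_inc n (map (nth 0 J) J').
move: cJ => /Hv; rewrite hE => /Hv; apply; exists x => j' /mapP[j jJ ->].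
by have := Hx j jJ; rewrite ynn.
Qed.


(** * From the array to an ict-pattern *)

Fixpoint all_rows (M : structure L) (n : nat) :
    tup (rows P n) M -> tup Y M -> Prop :=
  match n return tup (rows P n) M -> tup Y M -> Prop with
  | 0 => fun _ _ => True
  | n'.+1 => fun r x => all_rows (tfst r) x /\ sat (phi n') (tcat x (tsnd r))
  end.

Lemma def_all_rows n : definable (fun M (b : tup (csum (rows P n) Y) M) =>
  all_rows (tfst b) (tsnd b)).
Proof.
elim: n => [|n IH] /=; first exact: def_true.
apply: def_and; last by apply: def_sat; prove_natural.
by apply: (def_comp (F := fun M b => tcat (tfst (tfst b)) (tsnd b)) IH); prove_natural.
Qed.

Lemma all_rows_col (M : structure L) (r : forall i, tup (P i) M) (x : tup Y M) n :
  all_rows (col r n) x <-> forall i, i < n -> sat (phi i) (tcat x (r i)).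
Proof.
elim: n => [|n IH] //=; rewrite IH; split=> [[H Hn] i|H].
  by rewrite ltnS leq_eqVlt => /orP[/eqP->//|]; exact: H.
by split=> [i i_n|]; apply: H => //; exact: ltnW.
Qed.

Variable b : tup Y C.
Hypothesis b_sat : forall i, sat (phi i) (tcat b (d i)).

Definition ict_pattern (M : structure L) (y : tup (cells P) M) (n m : nat)
    (r : nat -> nat) := exists x : tup Y M, forall i, i < n -> forall j, j < m ->
  sat (phi i) (tcat x (cell y i j)) <-> j = r i.

Lemma def_pattern n m r :
  definable (fun M (y : tup (cells P) M) => ict_pattern y n m r).
Proof.
apply: (def_ex (D := fun M b => forall i, i < n -> forall j, j < m ->
  sat (phi i) (tcat (tsnd b) (cell (tfst b) i j)) <-> j = r i)).
apply: def_all_lt => i; apply: def_all_lt => j; apply: def_iff; last exact: def_const.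
by apply: def_sat; prove_natural; apply: natural_cell; prove_natural.
Qed.

(** Some [x] satisfies all [phi i] along the branch of columns [k i * m], as [b] does along [d]. In
    row [i] fewer than [k i] columns satisfy [phi i] with [x], so enough columns on both sides do
    not; indiscernibility moves the chosen columns to the first [m]. *)
Lemma finite_pattern n : exists e : tup (cells P) C,
  forall m r, (forall i, i < n -> r i < m) -> ict_pattern e n m r.
Proof.
have [|e [e_type e_inc e_ind _]] := @approx_array n.
  by elim: n => [|n]; [exact: approx0|exact: approxS].
exists e => m r rm.
have [w Hw] : definable (fun M (a : tup (csum (cset A) (rows P n)) M) =>
    exists x : tup Y M, all_rows (tsnd a) x).
  apply: (def_ex (D := fun M a => all_rows (tsnd (tfst a)) (tsnd a))).
  apply: (def_comp (F := fun M a => tcat (tsnd (tfst a)) (tsnd a)) (def_all_rows n)).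
  by prove_natural.
have /e_type/(_ (fun i => k i * m))/Hw[x] : sat w (tcat tA (col d n)).
  by apply/Hw; exists b; apply/all_rows_col.
move=> /all_rows_col Hx.
have Ht i : exists t, incr t /\ (i < n -> t (r i) = k i * m /\
    forall j, j < m -> j <> r i -> ~ sat (phi i) (tcat x (cell e i (t j)))).
  have [i_n|] := boolP (i < n); last by exists id; split.
  have [|t [? ? ?]] := @incr_avoiding (fun j => sat (phi i) (tcat x (cell e i j)))
      (k i) m (r i) _ (rm i i_n); last by exists t.
  by move=> J uJ sJ HJ; apply: (e_inc i i_n J uJ sJ); exists x.
have [t Ht'] := choice Ht.
have := def_teq (e_ind t (fun i => (Ht' i).1)) (def_comp (F := fun M a => tsnd a)
  (def_pattern n m r) (@natural_snd _ _ _ _ _ (@natural_id _ _))).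
move=> <-; exists x => i i_n j jm.
have [_ /(_ i_n)[tr tj]] := Ht' i.
split=> [S|->]; first by apply: contrapT => /(tj j jm); apply.
by have := Hx i i_n; rewrite -tr.
Qed.

Lemma infinite_pattern : exists e : tup (cells P) C,
  forall n m r, (forall i, i < n -> r i < m) -> ict_pattern e n m r.
Proof.
have /choice[e_ He] := finite_pattern.
have [|y Dy] := filter_limit e_ satC kinf (z := tA) (z' := tA) _
    (@cell_rank_inj L P) eventually_filter (fun _ => id).
  by rewrite range_of_tset.
exists y => n m r rm.
have := Dy _ (def_comp (F := fun M a => tsnd a)
  (def_pattern n m r) (@natural_snd _ _ _ _ _ (@natural_id _ _))).
(* [r] is bounded on the first [n] rows only; [r'] sends the remaining rows to column [0]. *)
apply; exists n => // n' /= nn'; pose r' i := if i < n then r i else 0.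
(* Without columns [r'] has no admissible value, but the pattern is vacuous. *)
case: m rm => [|m] rm; first by exists b.
have [|x Hx] := He n' m.+1 r'.
  by move=> i _; rewrite /r'; case: ifP => // /rm.
exists x => i i_n j jm; have := Hx i (leq_trans i_n nn') j jm.
by rewrite /r' i_n.
Qed.

End Array.

(** * Counting formulas *)

Section Coding.
Variable L : language.
Let U := formula (call L).

(** [Imp] serves as a pairing function: coding data by formulas gives bounds by |T| from injections,
    without cardinal arithmetic. *)
Fixpoint nat_code (n : nat) : U := if n is n'.+1 then Imp Fls (nat_code n') else Fls.

Fixpoint seq_code (l : seq U) : U := if l is x :: l' then Imp x (seq_code l') else Fls.

Definition sort_code (s : lsort L) : U :=
  let x : term (call L) s := Var ((s, 0) : call L) in Eql x x.

Definition fsym_code (f : Defs.fsym L) : U :=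
  let t : term (call L) (fcod f) :=
    App (fun i => Var ((@fdom L f i, 0) : call L) : term (call L) (@fdom L f i)) in
  Eql t t.

Definition rsym_code (r : rsym L) : U :=
  Rel (fun i => Var ((@rdom L r i, 0) : call L) : term (call L) (@rdom L r i)).

Lemma Imp_inj (x y x' y' : U) : Imp x y = Imp x' y' -> x = x' /\ y = y'.
Proof. by case. Qed.

Lemma nat_code_inj : injective nat_code.
Proof. by elim=> [|n IH] [|m] //= [/IH->]. Qed.

Lemma seq_code_inj : injective seq_code.
Proof. by elim=> [|x l IH] [|x' l'] //= [-> /IH->]. Qed.

Lemma sort_code_inj : injective sort_code.
Proof.
move=> s s' /(congr1 (fun phi : U => if phi is Eql s t u then Some s else None)).
by case.
Qed.

Lemma fsym_code_inj : injective fsym_code.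
Proof.
move=> f f' /(congr1 (fun phi : U => if phi is Eql s t u then
  (if t is App f u then Some f else None) else None)).
by case.
Qed.

Lemma rsym_code_inj : injective rsym_code.
Proof.
by move=> r r' /(congr1 (fun phi : U => if phi is Rel r t then Some r else None)) [].
Qed.

Fixpoint term_code (X : ctx L) (v : X -> U) s (t : term X s) : U :=
  match t with
  | Var x => Imp (nat_code 0) (v x)
  | App f u => Imp (nat_code 1)
      (Imp (fsym_code f) (seq_code (map (fun i => term_code v (u i)) (enum 'I_(farity f)))))
  end.

Definition ext_code (X : ctx L) s (v : X -> U) : cext X s -> U :=
  fun o => if o is Some x then Imp Fls (v x) else Fls.

Fixpoint fml_code (X : ctx L) (v : X -> U) (phi : formula X) : U :=
  match phi with
  | Fls => Imp (nat_code 0) Fls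
  | Eql s t u => Imp (nat_code 1) (Imp (sort_code s) (Imp (term_code v t) (term_code v u)))
  | Rel r t => Imp (nat_code 2)
      (Imp (rsym_code r) (seq_code (map (fun i => term_code v (t i)) (enum 'I_(rarity r)))))
  | Imp phi psi => Imp (nat_code 3) (Imp (fml_code v phi) (fml_code v psi))
  | All s phi => Imp (nat_code 4) (Imp (sort_code s) (fml_code (ext_code (s := s) v) phi))
  end.

Lemma existT_inj (I : Type) (F : I -> Type) i (x y : F i) :
  existT F i x = existT F i y -> x = y.
Proof.
by move=> E; have := projT2_eq E; rewrite (Prop_irrelevance (projT1_eq E) erefl).
Qed.

Lemma map_enum_inj (I : finType) (V : Type) (f g : I -> V) :
  map f (enum I) = map g (enum I) -> forall i, f i = g i.
Proof. by move=> /eq_in_map H i; apply: H; rewrite mem_enum. Qed.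

Lemma term_code_inj (X : ctx L) (v : X -> U) : injective v ->
  forall s (t : term X s) s' (t' : term X s'), term_code v t = term_code v t' ->
  existT (term X) s t = existT (term X) s' t'.
Proof.
move=> vI s; elim=> [x|f u IH] s' [x'|f' u'] //=.
  by case=> /vI ->.
move=> /Imp_inj[_ /Imp_inj[/fsym_code_inj ff']].
case: _ / ff' u' => u' /seq_code_inj/map_enum_inj H.
congr (existT _ _ (App _)); apply: functional_extensionality_dep => i.
exact: existT_inj (IH i _ _ (H i)).
Qed.

Lemma fml_code_inj (X : ctx L) (v : X -> U) : injective v -> injective (fml_code v).
Proof.
move=> vI phi; elim: phi v vI => {X}
  [X|X s t u|X r t|X phi IH1 psi IH2|X s phi IH] v vI [|s' t' u'|r' t'|phi' psi'|s' phi'] //.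
- move=> /Imp_inj[_ /Imp_inj[/sort_code_inj ss' /Imp_inj[]]].
  subst s' => tt' uu'.
  by rewrite (existT_inj (term_code_inj vI tt')) (existT_inj (term_code_inj vI uu')).
- move=> /Imp_inj[_ /Imp_inj[/rsym_code_inj rr']].
  case: _ / rr' t' => t' /seq_code_inj/map_enum_inj H.
  congr Rel; apply: functional_extensionality_dep => i.
  exact: existT_inj (term_code_inj vI (H i)).
- by move=> /Imp_inj[_ /Imp_inj[/(IH1 _ vI) -> /(IH2 _ vI) ->]].
move=> /Imp_inj[_ /Imp_inj[/sort_code_inj ss']]; case: _ / ss' phi' => phi' /(IH _ _) -> //.
by move=> [x|] [x'|] //= [/vI ->].
Qed.

(** The codes [w] keep the variables of [Y] apart from the parameter variables by starting with
    [Fls] and with [Imp Fls Fls]. *)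
Lemma par_fml_code (Y : ctx L) : [set: Y] #<= card_theory L ->
  exists code : {P : fctx L & formula (csum Y P)} -> U, injective code.
Proof.
move=> /card_le_inj[v0 [_ v0I]].
pose v y := v0 y I; have {v0I}vI : injective v by move=> y y'; exact: v0I.
pose w (P : fctx L) (x : csum Y P) : U :=
  match x with inl y => Imp Fls (v y) | inr i => Imp (Imp Fls Fls) (nat_code i) end.
have wI P : injective (@w P).
  move=> [y|i] [y'|i'] //= [].
    by move=> /vI ->.
  by move=> /nat_code_inj/val_inj ->.
exists (fun p => Imp (nat_code (flen (projT1 p)))
  (Imp (seq_code (map (fun i => sort_code (@fsrt L (projT1 p) i)) (enum 'I_(flen (projT1 p)))))
       (fml_code (@w (projT1 p)) (projT2 p)))).
move=> [[n s] phi] [[n' s'] phi'] /= /Imp_inj[/nat_code_inj nn' /Imp_inj[]]; subst n'.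
move=> /seq_code_inj/map_enum_inj ss'.
have {}ss' : s = s' by apply/funext => i; exact: sort_code_inj.
by subst s' => /(fml_code_inj (wI _)) ->.
Qed.

Lemma nat_le_theory : [set: nat] #<= card_theory L.
Proof. by apply: (@fun_card_le _ _ _ _ nat_code) => // n m _ _; exact: nat_code_inj. Qed.

(** If all fibers were finite, the code of [f i] paired with a numbering of the fiber of [i] would
    inject [S] into the formulas. *)
Lemma infinite_fiber (I V : Type) (S : set I) (f : I -> V) (code : V -> U) :
  injective code -> ~ (S #<= card_theory L) ->
  exists v, infinite_set [set i | S i /\ f i = v].
Proof.
move=> codeI nS; apply: contrapT => nv; apply: nS.
have /choice[g gI] v : exists g : I -> nat,
    {in [set i | S i /\ f i = v] &, injective g}.
  apply/pcard_injP; apply: finite_set_countable; apply: contrapT => inf.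
  by apply: nv; exists v.
pose F i := Imp (code (f i)) (nat_code (g (f i) i)).
apply: (@fun_card_le _ _ _ _ F) => // i j Si Sj.
move=> /Imp_inj[/codeI fij /nat_code_inj]; rewrite fij => /gI; apply; rewrite inE //.
Qed.

End Coding.

(** Each term is the least element of [S] not chosen before. *)
Lemma increasing_sequence (I : Type) (R : rel I) (S : set I) :
  wochoice.well_order R -> infinite_set S -> exists s : nat -> I,
    (forall n, S (s n)) /\ forall m n, m < n -> R (s m) (s n) /\ s m <> s n.
Proof.
move=> wR infS.
have /choice[pick Hp] (F : set I) : exists i, finite_set F ->
    (S i /\ ~ F i) /\ forall j, S j -> ~ F j -> R i j.
  have [fF|] := pselect (finite_set F); last first.
    by have [i _] := infinite_setN0 infS; exists i.
  have [|i [[/asboolP[Si Fi] min] _]] := wR (fun i => `[< S i /\ ~ F i >]).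
    have [i [Si nFi]] := infinite_setN0 (infinite_setD infS fF).
    by exists i; apply/asboolP.
  by exists i => _; split=> // j Sj nFj; apply: min; apply/asboolP.
pose F := fix F n : set I := if n is n'.+1 then F n' `|` [set pick (F n')] else set0.
have fF n : finite_set (F n).
  by elim: n => [|n IH] /=; [exact: finite_set0|rewrite finite_setU; split].
have FS m n : m < n -> F m.+1 `<=` F n.
  elim: n => // n IH; rewrite ltnS leq_eqVlt => /orP[/eqP->//|/IH H].
  exact: subset_trans H (@subsetUl _ _ _).
exists (fun n => pick (F n)); split=> [n|m n mn].
  by have [[]] := Hp _ (fF n).
have [[Sn nFn] _] := Hp _ (fF n); have [_ min] := Hp _ (fF m).
split; first by apply: min => // Fm; apply: nFn; apply: (FS m n mn); left.
by move=> E; apply: nFn; apply: (FS m n mn); right; rewrite /= E.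
Qed.

(** * Dividing along a strictly nonforking sequence *)

(** The common core of both parts. Freeness over everything before [s n] covers the parameters of
    the earlier formulas. Dividing is given by explicit sequences, so that (i) may replace [b] and
    the formulas by finite parts. *)
Lemma dividing_pattern (L : language) (T : set (sentence L))
    (kappa kappa' : Type) (C N : structure L) (h : forall s, C s -> N s)
    (A : set (elt C)) (I : Type) (R : rel I) (X : I -> fctx L)
    (a : forall i, tup (X i) C) (s : nat -> I) (Y : fctx L) (b : tup Y C)
    (P : nat -> fctx L) (phi : forall n, formula (csum Y (P n)))
    (d : forall n, tup (P n) C) :
  dependent T -> monster T kappa C -> monster T kappa' N -> elementary h ->
  card_lt [set: elt C] [set: kappa'] -> card_lt A [set: kappa] ->
  strictly_nonforking h A R a ->
  (forall m n, m < n -> R (s m) (s n) /\ s m <> s n) ->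
  (forall n, range_of (@d n) `<=` A `|` range_of (a (s n))) ->
  (forall n, sat (phi n) (tcat b (@d n))) ->
  (forall n, exists (k : nat) (c : nat -> tup (P n) C),
    (forall j, teq (@tset L C A) (c j) (@d n)) /\
    forall J : seq nat, uniq J -> size J = k ->
      ~ exists x : tup Y C, forall j, j \in J -> sat (phi n) (tcat x (c j))) ->
  exists e : tup (cells P) C, forall n m r,
    (forall i, i < n -> r i < m) -> ict_pattern phi e n m r.
Proof.
move=> T_dep [_ Tk satC homC] [NT _ satN _] hE smallC smallA nf sR dA bd.
move=> /dchoice[k /dchoice[c Hc]].
have kinf : [set: nat] #<= [set: kappa].
  by have [Tk' _] := Tk; exact: card_le_trans (nat_le_theory L) Tk'.
apply: (@infinite_pattern L T kappa C N h A T_dep NT satC homC hE kinf smallA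
  Y P phi d k c _ _ _ b).
- by move=> i j; have [H _] := Hc i.
- by move=> i; have [_ H] := Hc i.
- move=> n; apply: (strictly_free_witness hE satN smallC (nf (s n))).
  + exact: subsetUl.
  + move=> e /range_of_col[i i_n /dA[Ae|ae]]; first by left.
    by right; exists (s i); have [? ?] := sR i n i_n.
  + exact: dA.
- exact: bd.
Qed.

Lemma pattern_IP L (M : structure L) (Y Q : fctx L) (phi : formula (csum Y Q))
    (e : tup (cells (fun=> Q)) M) :
  (forall n m r, (forall i, i < n -> r i < m) -> ict_pattern (fun=> phi) e n m r) ->
  has_IP M phi.
Proof.
move=> He; exists (fun i => cell e i 0) => S F fF FS.
have [|n Hn] := @finite_bound _ F (fun psi i =>
  (S i /\ psi = PFml phi (cell e i 0)) \/ (~ S i /\ psi = PFml (Neg phi) (cell e i 0))) fF.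
  by move=> psi /FS[[i Si <-]|[i Si <-]]; exists i; [left|right].
(* The path goes through column [0] exactly in the rows of [S], and only column [0] is read; column
   [1] is there to be chosen otherwise. *)
have [|x Hx] := He n 2 (fun i => if `[< S i >] then 0 else 1).
  by move=> i _; case: ifP.
exists x => psi /Hn[i /Hx/(_ 0 isT)[H1 H2] [[Si ->]|[nSi ->]]]; rewrite /psat /=.
  by apply: H2; case: asboolP.
by move=> /H1; case: asboolP.
Qed.

Lemma pattern_not_strongly_dependent L (T : set (sentence L)) (M : structure L)
    (Y : fctx L) (P : nat -> fctx L) (phi : forall n, formula (csum Y (P n)))
    (e : tup (cells P) M) : models M T ->
  (forall n m r, (forall i, i < n -> r i < m) -> ict_pattern phi e n m r) ->
  ~ strongly_dependent T.
Proof.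
move=> MT He; apply; exists M; split=> //.
exists Y, P, phi, (fun i j => cell e i j) => eta F fF FS.
have [|n Hn] := @finite_bound _ F (fun psi m => exists i j, [/\ i <= m, j <= m &
  (j = eta i /\ psi = PFml (phi i) (cell e i j)) \/
  (j <> eta i /\ psi = PFml (Neg (phi i)) (cell e i j))]) fF.
  move=> psi /FS[[i ->]|[i [j [ji ->]]]].
    exists (maxn i (eta i)), i, (eta i); rewrite leq_maxl leq_maxr; split=> //.
    by left.
  exists (maxn i j), i, j; rewrite leq_maxl leq_maxr; split=> //.
  by right.
(* The columns must include those mentioned in [F] and the values of [eta] on the first [n] rows. *)
have [|x Hx] := He n (maxn n (\max_(i < n) eta i).+1) eta.
  move=> i i_n; rewrite leq_max ltnS.
  by rewrite (leq_bigmax (F := fun i : 'I_n => eta i) (Ordinal i_n)) orbT.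
exists x => psi /Hn[m mn [i [j [im jm H]]]].
have [H1 H2] := Hx i (leq_ltn_trans im mn) j
  (leq_trans (leq_ltn_trans jm mn) (leq_maxl _ _)).
case: H => -[Hj ->]; rewrite /psat /=; first exact: H2.
by move=> /H1.
Qed.

(** [b] may be infinite while the independence property concerns finite tuples. [w] depends on [phi]
    and not on [d], so one formula serves infinitely many indices; it still divides because a
    solution of [w] extends to one of [phi]. *)
Lemma divides_finite_support L (C : structure L) (A : set (elt C)) (Y : ctx L)
    (b : tup Y C) (Q : fctx L) (phi : formula (csum Y Q)) :
  exists (V : fctx L) (v : tup V C) (w : formula (csum V Q)),
  forall d : tup Q C, sat phi (tcat b d) -> divides A (PFml phi d) ->
    sat w (tcat v d) /\
    exists (k : nat) (c : nat -> tup Q C),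
      (forall j, teq (@tset L C A) (c j) d) /\
      forall J : seq nat, uniq J -> size J = k ->
        ~ exists x : tup V C, forall j, j \in J -> sat w (tcat x (c j)).
Proof.
have [phi' Hphi'] : definable (fun M (a : tup (csum Q Y) M) =>
    sat phi (tcat (tsnd a) (tfst a))) by apply: def_sat; prove_natural.
have [V [g [w' [gI Hw']]]] := fin_par phi'.
have [w Hw] : definable (fun M (a : tup (csum V Q) M) =>
    sat w' (tcat (tsnd a) (tfst a))) by apply: def_sat; prove_natural.
have wE (x : tup Y C) (d : tup Q C) :
    sat w (tcat (pull g x) d) <-> sat phi (tcat x d).
  by rewrite Hw /= -Hw' Hphi'.
exists V, (pull g b), w => d bd /divides_teq[k [c [cd cinc]]]; split; first exact/wE.
exists k, c; split=> // J uJ sJ [x Hx]; apply: (cinc J uJ sJ).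
(* [x] is extended by [b] off the image of [g]; on the image, injectivity of [g] makes the value
   well defined. *)
have /dchoice[x' Hx'] (y : Y) : exists m : C (srt y),
    forall i (e : g i = y),
      x i = ecast s (C s) (csrt g i) (ecast z (C (srt z)) (esym e) m).
  have [[i gi]|ni] := pselect (exists i, g i = y); last first.
    by exists (b y) => i e; case: ni; exists i.
  case: _ / gi; exists (ecast s (C s) (esym (csrt g i)) (x i)) => i' e.
  have ii' : i' = i by exact: gI.
  subst i'; rewrite (Prop_irrelevance e erefl) /=.
  have castK t t' (E : t = t') (z : C t') :
      z = ecast t (C t) E (ecast t (C t) (esym E) z) by case: _ / E z.
  exact: castK.
exists x' => j /Hx; suff <- : pull g x' = x by move/wE.
by apply: functional_extensionality_dep => i; rewrite (Hx' _ i erefl).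
Qed.

Theorem corollary5p3 (L : language) (T : set (sentence L))
    (kappa kappa' : Type) (C N : structure L) (h : forall s, C s -> N s)
    (A : set (elt C))
    (T_complete : complete T) (T_eq : equals_Teq T) (T_dep : dependent T)
    (C_monster : monster T kappa C)
    (N_monster : monster T kappa' N)
    (h_elem : elementary h)
    (C_small : card_lt [set: elt C] [set: kappa'])
    (A_small : card_lt A [set: kappa]) :
  (forall (I : Type) (R : rel I) (X : I -> fctx L)
          (a : forall i, tup (X i) C) (Y : ctx L) (b : tup Y C),
      successor_cardinal (card_theory L) R ->
      card_lt [set: I] [set: kappa] ->
      strictly_nonforking h A R a ->
      [set: Y] #<= card_theory L ->
      [set i | tp_divides A (tp b (A `|` range_of (a i)))] #<= card_theory L)
  /\
  (strongly_dependent T ->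
   forall (I : Type) (R : rel I) (X : I -> fctx L)
          (a : forall i, tup (X i) C) (Y : fctx L) (b : tup Y C),
      wochoice.well_order R ->
      card_lt [set: I] [set: kappa] ->
      infinite_set [set: I] ->
      strictly_nonforking h A R a ->
      finite_set [set i | tp_divides A (tp b (A `|` range_of (a i)))]).
Proof.
have [CT _ _ _] := C_monster.
split=> [I R X a Y b [wR _ _] _ nf Yle|sdep I R X a Y b wR _ _ nf]; apply: contrapT => nle.
  have [code codeI] := par_fml_code Yle.
  pose S := [set i | tp_divides A (tp b (A `|` range_of (a i)))].
  have /choice[f Hf] i : exists p : {P : fctx L & formula (csum Y P)}, S i ->
      exists d : tup (projT1 p) C, [/\ range_of d `<=` A `|` range_of (a i),
        sat (projT2 p) (tcat b d) & divides A (PFml (projT2 p) d)].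
    have [[[Q phi d] [[dA bd] div]]|nS] := pselect (S i).
      by exists (existT _ Q phi) => _; exists d.
    (* Indices outside [S] get an arbitrary formula. *)
    by exists (existT _ (cnil L) Fls).
  have [[Q phi] inf] := infinite_fiber f codeI nle.
  have [s [Ss sR]] := increasing_sequence wR inf.
  have [V [v [w Hw]]] := divides_finite_support A b phi.
  have Hd n : exists d : tup Q C, [/\ range_of d `<=` A `|` range_of (a (s n)),
      sat phi (tcat b d) & divides A (PFml phi d)].
    by have [/Hf Sn fE] := Ss n; move: Sn; rewrite fE.
  have {Hd}[d Hd] := choice Hd.
  have [|||e He] := dividing_pattern (b := v) (phi := fun=> w) (d := d)
      T_dep C_monster N_monster h_elem C_small A_small nf sR.
  - by move=> n; have [] := Hd n.
  - by move=> n; have [_ bd div] := Hd n; have [] := Hw _ bd div.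
  - by move=> n; have [_ bd div] := Hd n; have [] := Hw _ bd div.
  by apply: T_dep; exists C; split=> //; exists V, Q, w; exact: pattern_IP He.
have [s [Ss sR]] := increasing_sequence wR nle.
have /choice[psi Hpsi] n : exists psi, tp b (A `|` range_of (a (s n))) psi /\ divides A psi.
  exact: Ss.
have [|||e He] := dividing_pattern (b := b) (phi := fun n => pform (psi n))
    (d := fun n => par (psi n)) T_dep C_monster N_monster h_elem C_small A_small nf sR.
- by move=> n; have [[]] := Hpsi n.
- by move=> n; have [[]] := Hpsi n.
- by move=> n; have [_ /divides_teq] := Hpsi n.
exact: (pattern_not_strongly_dependent CT He sdep).
Qed.
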